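(* Let $E,F$ be two real Banach lattices and let $X$ be a real Banach space. Consider operators $S_1:E\to F$ and $S_2:F\to X$. If the operator $S_1$ is positive and is dominated by a DW-compact positive operator (i.e. $0\le S_1\le T$ for some DW-compact operator $T:E\to F$), and the operator $S_2$ is order weakly compact, then $S_2S_1$ is DW-compact.
   Context: Operators are bounded and linear. For $A\subset E$, $Sol(A)=\{y\in E: |y|\le |x| \text{ for some } x\in A\}$. A bounded subset $A$ of a Banach lattice $E$ is disjointly weakly compact if every disjoint sequence in $Sol(A)$ converges weakly to zero. A bounded linear operator $T$ from $E$ to a Banach space is DW-compact if $T(A)$ is relatively (norm) compact for each disjointly weakly compact $A\subset E$. A bounded linear operator from a Banach lattice to a Banach space is order weakly compact if it maps order bounded sets onto relatively weakly compact sets. *)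

(* Defs.v *)
From HB Require Import structures.
From mathcomp Require Import all_boot all_order all_algebra.
From mathcomp Require Import all_classical all_reals all_analysis.

Set Implicit Arguments.
Unset Strict Implicit.
Unset Printing Implicit Defensive.

Import Order.TTheory GRing.Theory Num.Theory.
Import numFieldNormedType.Exports.

Local Open Scope classical_set_scope.
Local Open Scope ring_scope.

(* The order operations have their own names instead of coming from
   Order.Lattice: a structure joining Order.Lattice with modules would compete
   with numDomainType and realDomainType in canonical structure inference. *)
HB.mixin Record Lmodule_isVectorLattice (R : realType) E of GRing.Lmodule R E := {
  vle : rel E ;
  vmeet : E -> E -> E ;
  vjoin : E -> E -> E ;
  vle_refl : reflexive vle ;
  vle_anti : antisymmetric vle ;
  vle_trans : transitive vle ;
  vle_meet : forall x y z : E, vle x (vmeet y z) = vle x y && vle x z ;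
  vle_join : forall x y z : E, vle (vjoin x y) z = vle x z && vle y z ;
  vleD2r : forall x y z : E, vle x y -> vle (x + z) (y + z) ;
  vle_scale_ge0 : forall (a : R) (x : E), 0 <= a -> vle 0 x -> vle 0 (a *: x)
}.

#[short(type="vectorLatticeType")]
HB.structure Definition VectorLattice (R : realType) :=
  {E of GRing.Lmodule R E & Lmodule_isVectorLattice R E}.

Notation "x <=v y" := (vle x y) (at level 70, no associativity) : ring_scope.

(* A copy of E through which the library's theory of lattices applies. *)
Definition ordered (R : realType) (E : vectorLatticeType R) : Type := E.

HB.instance Definition _ (R : realType) (E : vectorLatticeType R) :=
  Choice.on (ordered E).
HB.instance Definition _ (R : realType) (E : vectorLatticeType R) :=
  Order.Le_isPOrder.Build ring_display (ordered E)
    (@vle_refl R E) (@vle_anti R E) (@vle_trans R E).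
HB.instance Definition _ (R : realType) (E : vectorLatticeType R) :=
  Order.POrder_MeetJoin_isLattice.Build ring_display (ordered E)
    (@vle_meet R E) (@vle_join R E).

(* The lattice modulus |x|; the notation `|x| is the norm. *)
Definition modulus (R : realType) (E : vectorLatticeType R) (x : E) : E :=
  vjoin x (- x).

HB.mixin Record VectorLattice_isBanachLattice (R : realType) E
    of CompleteNormedModule R E & VectorLattice R E := {
  vle_modulus_norm : forall x y : E, modulus x <=v modulus y -> `|x| <= `|y|
}.

#[short(type="banachLatticeType")]
HB.structure Definition BanachLattice (R : realType) :=
  {E of CompleteNormedModule R E & VectorLattice R E
      & VectorLattice_isBanachLattice R E}.

Definition continuous_dual (R : realType) (E : normedModType R) : Type :=
  {f : {linear E -> R^o} | continuous f}.

(* A copy of E carrying the coarsest topology that makes every element of the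
   continuous dual continuous. *)
Definition weak_type (R : realType) (E : normedModType R) : Type :=
  sup_topology (fun f : continuous_dual E =>
    Topological.class (initial_topology (sval f : E -> R^o))).

HB.instance Definition _ (R : realType) (E : normedModType R) :=
  Topological.on (weak_type E).

Definition weakly_cvg (R : realType) (E : normedModType R)
    (u : nat -> E) (l : E) : Prop :=
  (u : nat -> weak_type E) @ \oo --> (l : weak_type E).

Definition relatively_weakly_compact (R : realType) (E : normedModType R)
    (A : set E) : Prop :=
  precompact (A : set (weak_type E)).

Section banach_lattice_notions.
Variables (R : realType) (E : banachLatticeType R).

Definition Sol (A : set E) : set E :=
  [set y | exists2 x, A x & modulus y <=v modulus x].

Definition disjoint_seq (u : nat -> E) : Prop :=
  forall m n, m != n -> vmeet (modulus (u m)) (modulus (u n)) = 0.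

Definition disjointly_weakly_compact (A : set E) : Prop :=
  bounded_set A /\
  forall u : nat -> E,
    (forall n, Sol A (u n)) -> disjoint_seq u -> weakly_cvg u 0.

Definition order_bounded (A : set E) : Prop :=
  exists a b : E, A `<=` [set x | a <=v x /\ x <=v b].

End banach_lattice_notions.

Section operators.
Variables (R : realType) (E : banachLatticeType R).

Definition DW_compact (X : completeNormedModType R) (T : {linear E -> X}) :
    Prop :=
  bounded_fun_norm T /\
  forall A : set E, disjointly_weakly_compact A -> precompact (T @` A).

Definition order_weakly_compact (X : completeNormedModType R)
    (T : {linear E -> X}) : Prop :=
  bounded_fun_norm T /\
  forall A : set E, order_bounded A -> relatively_weakly_compact (T @` A).

Definition positive_operator (F : banachLatticeType R) (T : {linear E -> F}) :
    Prop :=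
  forall x : E, 0 <=v x -> 0 <=v T x.

Definition operator_le (F : banachLatticeType R) (S T : {linear E -> F}) :
    Prop :=
  forall x : E, 0 <=v x -> S x <=v T x.

End operators.

(* Main.v *)
(* Let A be disjointly weakly compact and 0 <= S1 <= T with T DW-compact.  Disjoint
   sequences of Sol(A) are weakly null, hence T-null, so for every eps there is u >= 0
   with ||T (|x| - u)^+|| <= eps on A; as S1 <= T, this reduces the claim to the total
   boundedness of S2 S1 [0, u].  On [0, T u], weak compactness bounds ||S2 w||, w >= 0,
   by phi w + eps for one positive functional phi, so it suffices to find a finite
   covering of S1 [0, u] for the seminorm phi |.|.

   Consider the bilinear forms b_S (y, g) = g (S1 y) <= b_T (y, g) = g (T y) with
   0 <= y <= u and 0 <= g <= phi.  Among all finite decompositions u = sum x_i and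
   phi = sum g_j, take one nearly maximizing the energy
   sum b_S (x_i, g_j)^2 / b_T (x_i, g_j).  It barely increases under refinement, so, up
   to eps and uniformly in 0 <= y_i <= x_i and 0 <= q_j <= g_j, b_S (y_i, q_j) is a
   fixed multiple of b_T (y_i, q_j) with a coefficient in [0, 1].  Since T [0, x_i] is
   relatively compact, this controls S1 y uniformly in q. *)

Require Import Defs.
From HB Require Import structures.
From mathcomp Require Import all_boot all_order all_algebra.
From mathcomp Require Import all_classical all_reals all_analysis.
From mathcomp Require Import ring lra.

Set Implicit Arguments.
Unset Strict Implicit.
Unset Printing Implicit Defensive.

Import Order.TTheory GRing.Theory Num.Theory.
Import numFieldNormedType.Exports.

Local Open Scope classical_set_scope.
Local Open Scope ring_scope.

(** * The Hahn-Banach theorem *)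

Section hahn_banach.
Variables (R : realType).

Definition sublinear (V : lmodType R) (p : V -> R) : Prop :=
  (forall u v, p (u + v) <= p u + p v) /\
  (forall a u, 0 <= a -> p (a *: u) <= a * p u).

Lemma sublinear_ge (V : lmodType R) (p : V -> R) (v : V) :
  sublinear p -> - p (- v) <= p v.
Proof.
move=> [pD pZ].
have := pD v (- v); have := pD 0 0; rewrite subrr addr0.
lra.
Qed.

(** Lowers [q] along a convex cone [C] of constraints: taking [v = - c.1] gives
    [q' (- c.1) <= - c.2], so every linear minorant of [q'] is at least [c.2] at [c.1]. Both the
    additivity of minimal functionals and the extension theorem rest on this. *)
Lemma sublinear_inf (V : lmodType R) (q : V -> R) (C : set (V * R)) :
  sublinear q -> C (0, 0) ->
  (forall c d, C c -> C d -> C (c.1 + d.1, c.2 + d.2)) ->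
  (forall a c, 0 <= a -> C c -> C (a *: c.1, a * c.2)) ->
  (forall c, C c -> c.2 <= q c.1) ->
  exists q', [/\ sublinear q', (forall v, q' v <= q v) &
     forall c v, C c -> q' v <= q (v + c.1) - c.2].
Proof.
move=> sq C0 CD CZ Cq; have [qD qZ] := sq.
pose S v := [set q (v + c.1) - c.2 | c in C].
have Slb v : has_lbound (S v).
  exists (- q (- v)) => _ [c Cc <-].
  have := qD (v + c.1) (- v); rewrite addrAC subrr add0r.
  have := Cq c Cc; lra.
have Sinf v : has_inf (S v).
  by split => //; exists (q (v + 0) - 0); exists (0, 0).
pose q' v := inf (S v).
have q'le c v : C c -> q' v <= q (v + c.1) - c.2.
  by move=> Cc; apply: ge_inf => //; exists c.
have q'ge v x : (forall c, C c -> x <= q (v + c.1) - c.2) -> x <= q' v.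
  move=> H; apply: lb_le_inf; first by case: (Sinf v).
  by move=> _ [c Cc <-]; exact: H.
exists q'; split => //; last first.
  by move=> v; have := q'le _ v C0; rewrite addr0 subr0.
have q'D u v : q' (u + v) <= q' u + q' v.
  rewrite -lerBlDr; apply: (@q'ge) => c Cc.
  rewrite lerBlDr -lerBlDl; apply: (@q'ge) => d Cd.
  rewrite lerBlDl; apply: (le_trans (q'le _ _ (CD _ _ Cc Cd))) => /=.
  have := qD (v + d.1) (u + c.1).
  have -> : v + d.1 + (u + c.1) = u + v + (c.1 + d.1).
    by rewrite addrACA [d.1 + _]addrC [v + u]addrC.
  lra.
split => // a u; rewrite le_eqVlt => /orP[/eqP<-|a0].
  rewrite scale0r mul0r; apply: (le_trans (q'le _ 0 C0)); rewrite /= addr0 subr0.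
  by have := qZ 0 0 (lexx _); rewrite scale0r mul0r.
rewrite -ler_pdivrMl//; apply: (@q'ge) => c Cc.
rewrite ler_pdivrMl//.
apply: (le_trans (q'le _ _ (CZ _ _ (ltW a0) Cc))) => /=.
by rewrite -scalerDr mulrBr lerD2r qZ// ltW.
Qed.

(** Supplies the bounds of chains for Zorn's lemma. Sublinearity and [q <= p] give
    [- p (- v) <= q v], so the infimum is finite; of two members of the chain the smaller serves
    both terms of a sum, which makes the infimum subadditive. *)
Lemma sublinear_chain_inf (V : lmodType R) (p : V -> R) (A : set (V -> R)) :
  A !=set0 -> (forall q, A q -> sublinear q /\ forall v, q v <= p v) ->
  (forall q r, A q -> A r -> (forall v, q v <= r v) \/ (forall v, r v <= q v)) ->
  exists q', sublinear q' /\ forall q, A q -> forall v, q' v <= q v.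
Proof.
move=> [q0 Aq0] Asub Atot.
pose S v := [set q v | q in A].
have Slb v : has_lbound (S v).
  exists (- p (- v)) => _ [q /Asub [sq qp] <-].
  by apply: le_trans (sublinear_ge _ sq); rewrite lerN2.
have S0 v : S v !=set0 by exists (q0 v), q0.
pose q' v := inf (S v).
have q'le q v : A q -> q' v <= q v.
  by move=> Aq; apply: ge_inf => //; exists q.
have q'ge v x : (forall q, A q -> x <= q v) -> x <= q' v.
  by move=> H; apply: lb_le_inf => // _ [q Aq <-]; exact: H.
exists q'; split; last by move=> q Aq v; exact: q'le.
split=> [u v|a u a0].
  rewrite -lerBlDr; apply: (@q'ge) => q Aq.
  rewrite lerBlDr -lerBlDl; apply: (@q'ge) => r Ar; rewrite lerBlDl.
  have [[qD _] _] := Asub _ Aq; have [[rD _] _] := Asub _ Ar.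
  have [qr|rq] := Atot _ _ Aq Ar.
    by apply: (le_trans (q'le _ _ Aq)); apply: (le_trans (qD _ _)); rewrite lerD.
  by apply: (le_trans (q'le _ _ Ar)); apply: (le_trans (rD _ _)); rewrite lerD.
move: a0; rewrite le_eqVlt => /orP[/eqP<-|a0].
  rewrite mul0r; apply: (le_trans (q'le _ _ Aq0)).
  have [[_ qZ] _] := Asub _ Aq0.
  by have := qZ 0 u (lexx _); rewrite mul0r.
rewrite -ler_pdivrMl//; apply: (@q'ge) => q Aq; rewrite ler_pdivrMl//.
apply: (le_trans (q'le _ _ Aq)).
by have [[_ qZ] _] := Asub _ Aq; rewrite qZ// ltW.
Qed.

(* A minimal sublinear functional is linear. *)
Lemma sublinear_linear_minorant (V : lmodType R) (p : V -> R) :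
  sublinear p -> exists g : {linear V -> R^o}, forall v, g v <= p v.
Proof.
move=> sp.
pose T := {q : V -> R | sublinear q /\ forall v, q v <= p v}.
(* The order is reversed: a maximal element for [le] is a minimal functional. *)
pose le (s t : T) := `[< forall v, sval t v <= sval s v >].
have [||||[q [sq qp]] qmin] := @Zorn T le.
- by move=> t; apply/asboolP.
- move=> r s t /asboolP rs /asboolP st; apply/asboolP => v.
  exact: le_trans (st v) (rs v).
- move=> [s sps] [t tps] /asboolP/= st /asboolP/= ts; apply/eq_exist/funext => v.
  by apply/le_anti; rewrite st ts.
- move=> A Atot.
  have [[t0 At0]|A0] := pselect (A !=set0); last first.
    by exists (exist _ p (conj sp (fun=> lexx _))) => s As; case: A0; exists s.
  have [||| q' [sq' q'A]] := @sublinear_chain_inf V p [set sval t | t in A].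
  + by exists (sval t0), t0.
  + by move=> _ [t _ <-]; exact: (svalP t).
  + move=> _ _ [s As <-] [t At <-].
    by have [/asboolP|/asboolP] := Atot _ _ As At; [right|left].
  have q'p : forall v, q' v <= p v.
    move=> v; apply: (le_trans (q'A (sval t0) _ v)); first by exists t0.
    by case: (svalP t0) => _ t0p; exact: t0p.
  exists (exist _ q' (conj sq' q'p)) => s As; apply/asboolP => v /=.
  by apply: q'A; exists s.
have [qD qZ] := sq.
have qadd : forall v w, q (v + w) = q v + q w.
  move=> v w; apply/eqP; rewrite eq_le qD/=.
  (* By minimality, lowering [q] along the ray through [(w, q w)] cannot change it; this yields
     [q v + q w <= q (v + w)]. *)
  pose C : set (V * R) := [set c | exists2 t, 0 <= t & c = (t *: w, t * q w)].
  have [||||q' [sq' q'q q'C]] := @sublinear_inf V q C sq.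
  - by exists 0; rewrite ?scale0r ?mul0r.
  - move=> _ _ [s s0 ->] [t t0 ->] /=; exists (s + t); first exact: addr_ge0.
    by rewrite scalerDl mulrDl.
  - move=> a _ a0 [t t0 ->] /=; exists (a * t); first exact: mulr_ge0.
    by rewrite scalerA mulrA.
  - move=> _ [t t0 ->] /=; move: t0; rewrite le_eqVlt => /orP[/eqP<-|t0].
      rewrite scale0r mul0r; have := qD 0 0; rewrite addr0; lra.
    rewrite -ler_pdivlMl//; apply: le_trans (qZ _ _ _); last by rewrite invr_ge0 ltW.
    by rewrite scalerA mulVf ?gt_eqF// scale1r.
  have q'p : forall u, q' u <= p u by move=> u; exact: le_trans (q'q u) (qp u).
  have qE : q' = q.
    by have /(congr1 sval) := qmin (exist _ q' (conj sq' q'p)) (introT (asboolP _) q'q).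
  rewrite -lerBrDr.
  have := q'C (w, q w) v; rewrite qE; apply.
  by exists 1; rewrite ?scale1r ?mul1r.
have q0 : q 0 = 0 by have := qadd 0 0; rewrite addr0; lra.
have qN v : q (- v) = - q v by have := qadd v (- v); rewrite subrr; lra.
have qZp a v : 0 <= a -> q (a *: v) = a * q v.
  move=> a0; apply/eqP; rewrite eq_le qZ//=.
  by have := qZ a (- v) a0; rewrite scalerN !qN; lra.
have qlin : linear (q : V -> R^o).
  move=> a u v; rewrite qadd; congr (_ + _).
  have [a0|a0] := leP 0 a; first exact: qZp.
  have Na0 : 0 <= - a by lra.
  by have := qZp (- a) u Na0; rewrite scaleNr qN /GRing.scale/=; lra.
pose g := GRing.isLinear.Build _ _ _ _ (q : V -> R^o) qlin.
pose G : {linear V -> R^o} := HB.pack (q : V -> R^o) g.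
by exists G.
Qed.

(** Extension along a linear map instead of from a subspace; [f] vanishes on the kernel of [L]
    because [p 0 <= 0]. Lowering [p] along the pairs [(L u, f u)] makes every linear minorant at
    least [f], and passing to [- u] gives equality. *)
Lemma hahn_banach (U V : lmodType R) (p : V -> R) (L : {linear U -> V})
    (f : {linear U -> R^o}) :
  sublinear p -> (forall u, f u <= p (L u)) ->
  exists2 g : {linear V -> R^o}, (forall v, g v <= p v) & forall u, g (L u) = f u.
Proof.
move=> sp fp.
pose C : set (V * R) := [set c | exists u, c = (L u, f u)].
have [||||q [sq qp qC]] := @sublinear_inf V p C sp.
- by exists 0; rewrite !linear0.
- by move=> _ _ [u ->] [v ->]; exists (u + v); rewrite !linearD.
- by move=> a _ _ [u ->]; exists (a *: u); rewrite !linearZ.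
- by move=> _ [u ->]; exact: fp.
have [g gq] := sublinear_linear_minorant sq.
have gLf u : f u <= g (L u).
  have Cu : C (L u, f u) by exists u.
  have p0 : p 0 <= 0.
    by have [_ pZ] := sp; have := pZ 0 0 (lexx _); rewrite scale0r mul0r.
  have := qC _ (- L u) Cu; rewrite /= addNr.
  by have := gq (- L u); rewrite linearN; lra.
exists g => [v|u]; first exact: le_trans (gq v) (qp v).
apply/le_anti; rewrite gLf andbT.
by have := gLf (- u); rewrite !linearN; lra.
Qed.

End hahn_banach.

(** * Vector lattices *)

Section vector_lattice.
Variables (R : realType) (E : vectorLatticeType R).
Implicit Types (x y z : E) (a : R).

Definition vpos x : E := vjoin x 0.

Lemma vlexx x : x <=v x. Proof. exact: vle_refl. Qed.

Lemma vle_tran y x z : x <=v y -> y <=v z -> x <=v z.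
Proof. exact: vle_trans. Qed.

Lemma vle_eq x y : x <=v y -> y <=v x -> x = y.
Proof. by move=> xy yx; apply: vle_anti; rewrite xy yx. Qed.

Lemma vleD x y z t : x <=v y -> z <=v t -> x + z <=v y + t.
Proof.
move=> xy zt; apply: vle_tran (vleD2r _ _ z xy) _.
by rewrite ![y + _]addrC vleD2r.
Qed.

Lemma vsubr_ge0 x y : (0 <=v y - x) = (x <=v y).
Proof.
apply/idP/idP => [h|h]; first by have := vleD2r _ _ x h; rewrite add0r subrK.
by have := vleD2r _ _ (- x) h; rewrite subrr.
Qed.

Lemma vlerD2r z x y : (x + z <=v y + z) = (x <=v y).
Proof. by rewrite -vsubr_ge0 opprD addrACA subrr addr0 vsubr_ge0. Qed.

Lemma vlerBlDr x y z : (x - y <=v z) = (x <=v z + y).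
Proof. by rewrite -(vlerD2r y) subrK. Qed.

Lemma vlerN2 x y : (- x <=v - y) = (y <=v x).
Proof. by rewrite -vsubr_ge0 opprK addrC vsubr_ge0. Qed.

Lemma voppr_le0 x : (- x <=v 0) = (0 <=v x).
Proof. by rewrite -{1}[0]oppr0 vlerN2. Qed.

Lemma vaddr_ge0 x y : 0 <=v x -> 0 <=v y -> 0 <=v x + y.
Proof. by move=> x0 y0; rewrite -[X in X <=v _]addr0 vleD. Qed.

Lemma vlerDl x y : 0 <=v y -> x <=v x + y.
Proof. by move=> y0; rewrite -[X in X <=v _]addr0 vleD// vlexx. Qed.

Lemma vler_wpZ a x y : 0 <= a -> x <=v y -> a *: x <=v a *: y.
Proof.
by move=> a0; rewrite -vsubr_ge0 => xy; rewrite -vsubr_ge0 -scalerBr vle_scale_ge0.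
Qed.

Lemma vler_wpZl a b x : a <= b -> 0 <=v x -> a *: x <=v b *: x.
Proof.
by move=> ab x0; rewrite -vsubr_ge0 -scalerBl vle_scale_ge0// subr_ge0.
Qed.

Lemma vsumr_ge0 (I : Type) (r : seq I) (P : pred I) (F : I -> E) :
  (forall i, P i -> 0 <=v F i) -> 0 <=v \sum_(i <- r | P i) F i.
Proof.
by move=> F0; apply: (big_ind (fun x => 0 <=v x)) => //; [exact: vlexx|exact: vaddr_ge0].
Qed.

Lemma vle_joinl x y : x <=v vjoin x y.
Proof. by have := vlexx (vjoin x y); rewrite vle_join => /andP[]. Qed.

Lemma vle_joinr x y : y <=v vjoin x y.
Proof. by have := vlexx (vjoin x y); rewrite vle_join => /andP[]. Qed.

Lemma vle_meetl x y : vmeet x y <=v x.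
Proof. by have := vlexx (vmeet x y); rewrite vle_meet => /andP[]. Qed.

Lemma vle_meetr x y : vmeet x y <=v y.
Proof. by have := vlexx (vmeet x y); rewrite vle_meet => /andP[]. Qed.

Lemma vjoinDr x y z : vjoin x y + z = vjoin (x + z) (y + z).
Proof.
apply: vle_eq; last by rewrite vle_join !vlerD2r vle_joinl vle_joinr.
rewrite -[X in _ <=v X](subrK z) vlerD2r vle_join -(vlerD2r z x) -(vlerD2r z y).
by rewrite !subrK vle_joinl vle_joinr.
Qed.

Lemma vmeetDr x y z : vmeet x y + z = vmeet (x + z) (y + z).
Proof.
apply: vle_eq; first by rewrite vle_meet !vlerD2r vle_meetl vle_meetr.
rewrite -[X in X <=v _](subrK z) vlerD2r vle_meet -(vlerD2r z _ x).
by rewrite -(vlerD2r z _ y) !subrK vle_meetl vle_meetr.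
Qed.

Lemma voppr_join x y : - vjoin x y = vmeet (- x) (- y).
Proof.
apply: vle_eq; first by rewrite vle_meet !vlerN2 vle_joinl vle_joinr.
rewrite -vlerN2 opprK vle_join -(vlerN2 _ x) -(vlerN2 _ y) !opprK.
by rewrite vle_meetl vle_meetr.
Qed.

Lemma vjoinC x y : vjoin x y = vjoin y x.
Proof. by apply: vle_eq; rewrite vle_join vle_joinl vle_joinr. Qed.

Lemma vmeetC x y : vmeet x y = vmeet y x.
Proof. by apply: vle_eq; rewrite vle_meet vle_meetl vle_meetr. Qed.

Lemma vpos_ge0 x : 0 <=v vpos x. Proof. exact: vle_joinr. Qed.

Lemma vle_pos x : x <=v vpos x. Proof. exact: vle_joinl. Qed.

Lemma vpos_le x y : (vpos x <=v y) = (x <=v y) && (0 <=v y).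
Proof. exact: vle_join. Qed.

Lemma vpos_id x : 0 <=v x -> vpos x = x.
Proof. by move=> x0; apply: vle_eq; [rewrite vpos_le vlexx|exact: vle_pos]. Qed.

Lemma vpos_npos x : x <=v 0 -> vpos x = 0.
Proof. by move=> x0; apply: vle_eq; [rewrite vpos_le x0 vlexx|exact: vpos_ge0]. Qed.

Lemma vpos_homo x y : x <=v y -> vpos x <=v vpos y.
Proof. by move=> xy; rewrite vpos_le vpos_ge0 (vle_tran xy (vle_pos y)). Qed.

Lemma vpos_addN x : vpos x = x + vpos (- x).
Proof. by rewrite /vpos addrC vjoinDr addNr add0r vjoinC. Qed.

Lemma vposB x : vpos x - vpos (- x) = x.
Proof. by rewrite {1}vpos_addN addrK. Qed.

Lemma vposD x y : vpos (x + y) <=v vpos x + vpos y.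
Proof. by rewrite vpos_le vleD ?vle_pos// vaddr_ge0 ?vpos_ge0. Qed.

Lemma vposZ a x : 0 <= a -> vpos (a *: x) = a *: vpos x.
Proof.
have vposZ_le b y : 0 <= b -> vpos (b *: y) <=v b *: vpos y.
  by move=> b0; rewrite vpos_le vler_wpZ ?vle_pos// vle_scale_ge0 ?vpos_ge0.
rewrite le_eqVlt => /orP[/eqP<-|a0].
  by rewrite !scale0r vpos_id ?vlexx.
apply: vle_eq; first by rewrite vposZ_le ?ltW.
rewrite -[X in _ <=v X]scale1r -(mulfV (lt0r_neq0 a0)) -scalerA vler_wpZ ?ltW//.
apply: vle_tran (vposZ_le _ _ _); last by rewrite invr_ge0 ltW.
by rewrite scalerA mulVf ?gt_eqF// scale1r vlexx.
Qed.

Lemma vmeetE x y : vmeet x y = x - vpos (x - y).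
Proof.
have := voppr_join (- x) (- y); rewrite !opprK => <-.
by rewrite /vpos -{2}[x]opprK -opprD addrC vjoinDr addrAC subrr !add0r vjoinC.
Qed.

End vector_lattice.

(** * Moduli and disjointness *)

Section modulus.
Variables (R : realType) (E : vectorLatticeType R).
Implicit Types (x y z u v : E) (a : R).

Lemma vle_modulus x : x <=v modulus x. Proof. exact: vle_joinl. Qed.

Lemma modulusN x : modulus (- x) = modulus x.
Proof. by rewrite /modulus opprK vjoinC. Qed.

Lemma modulusE x : modulus x = vpos x + vpos (- x).
Proof.
have := vposZ x (ler0n R 2); rewrite !scaler_nat => h.
rewrite -[modulus x](addrK x) /modulus vjoinDr addNr -mulr2n -/(vpos _) h.
by rewrite mulr2n -addrA; congr (_ + _); rewrite {1}vpos_addN addrAC subrr add0r.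
Qed.

Lemma modulus_ge0 x : 0 <=v modulus x.
Proof. by rewrite modulusE vaddr_ge0 ?vpos_ge0. Qed.

Lemma vpos_le_modulus x : vpos x <=v modulus x.
Proof. by rewrite modulusE vlerDl ?vpos_ge0. Qed.

Lemma modulus_id x : 0 <=v x -> modulus x = x.
Proof. by move=> x0; rewrite modulusE vpos_id// vpos_npos ?addr0// voppr_le0. Qed.

Lemma vmeet_pos_opp x : vmeet (vpos x) (vpos (- x)) = 0.
Proof. by rewrite vmeetE vposB subrr. Qed.

Lemma vmeet_ge0 x y : 0 <=v x -> 0 <=v y -> 0 <=v vmeet x y.
Proof. by move=> x0 y0; rewrite vle_meet x0. Qed.

Lemma vmeet_homo x y u v : x <=v u -> y <=v v -> vmeet x y <=v vmeet u v.
Proof.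
move=> xu yv.
by rewrite vle_meet (vle_tran (vle_meetl _ _) xu) (vle_tran (vle_meetr _ _) yv).
Qed.

Lemma vjoinE x y : vjoin x y = y + vpos (x - y).
Proof. by rewrite addrC /vpos vjoinDr subrK add0r. Qed.

Lemma vmeetD_le x y z : 0 <=v x -> 0 <=v y -> 0 <=v z ->
  vmeet (x + y) z <=v vmeet x z + vmeet y z.
Proof.
move=> x0 y0 z0; rewrite [_ + vmeet y z]addrC vmeetDr vle_meet; apply/andP; split.
  rewrite [y + _]addrC vmeetDr vle_meet vle_meetl.
  by rewrite (vle_tran (vle_meetr _ _))// vlerDl.
by rewrite (vle_tran (vle_meetr _ _))// vlerDl// vmeet_ge0.
Qed.

(** As [a * c >= 1] and [c <= 1], the positive part of [y - c *: x] is at most that of [a *: y - x],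
    which is the negative part of [x - a *: y] and so disjoint from its positive part. *)
Lemma vmeet_pos_scale_eq0 x y a c : 0 <=v x -> 0 <=v y -> 0 <= c -> c <= 1 ->
  1 <= a * c -> vmeet (vpos (x - a *: y)) (vpos (y - c *: x)) = 0.
Proof.
move=> x0 y0 c0 c1 ac1.
apply: vle_eq; last by rewrite vmeet_ge0 ?vpos_ge0.
rewrite -(vmeet_pos_opp (x - a *: y)) vmeet_homo ?vlexx// opprB.
apply: (@vle_tran _ _ (c *: vpos (a *: y - x))).
  rewrite -vposZ// vpos_homo// scalerBr scalerA vleD ?vlexx//.
  by rewrite -[X in X <=v _]scale1r vler_wpZl// mulrC.
by rewrite -[X in _ <=v X]scale1r vler_wpZl ?vpos_ge0.
Qed.

(** The sum of disjoint positive elements is their join: by induction the partial sum is disjoint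
    from the next term. *)
Lemma sum_disjoint_le (u : nat -> E) (x : E) (n : nat) : 0 <=v x ->
  (forall i, 0 <=v u i) -> (forall i, u i <=v x) ->
  (forall i j, i != j -> vmeet (u i) (u j) = 0) ->
  \sum_(i < n) u i <=v x.
Proof.
move=> x0 u0 ux ud.
elim: n => [|n IH]; first by rewrite big_ord0.
have disj m k : (m <= k)%N -> vmeet (\sum_(i < m) u i) (u k) = 0.
  elim: m => [|m IHm] mk.
    by apply: vle_eq; rewrite big_ord0 ?vle_meetl// vmeet_ge0 ?vlexx.
  rewrite big_ord_recr /=.
  apply: vle_eq; last by rewrite vmeet_ge0 ?vaddr_ge0 ?vsumr_ge0.
  apply: vle_tran (vmeetD_le _ _ _) _; rewrite ?vsumr_ge0//.
  by rewrite IHm ?ud ?addr0 ?vlexx ?ltn_eqF// ltnW.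
have := disj n n (leqnn n); rewrite big_ord_recr/= vmeetE => /subr0_eq ->.
by rewrite addrC -vjoinE vle_join IH ux.
Qed.

(** Greedy choice: [vmeet y (x i)] at the first index leaves [vpos (y - x i)], which lies below the
    sum of the remaining [x j]. *)
Lemma riesz_decomposition (I : finType) (x : I -> E) (y : E) :
  (forall i, 0 <=v x i) -> 0 <=v y -> y <=v \sum_i x i ->
  exists y' : I -> E, (forall i, 0 <=v y' i /\ y' i <=v x i) /\ \sum_i y' i = y.
Proof.
move=> x0; have := index_enum_uniq I.
elim: (index_enum I) y => [|i s IH] y /= us y0.
  rewrite big_nil => yle; exists (fun=> 0); split.
    by move=> i; split; [exact: vlexx|].
  by rewrite big_nil; exact: vle_eq.
case/andP: us => iNs us; rewrite big_cons => yle.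
have [||y'' [y''x y''E]] := IH (vpos (y - x i)) us.
- exact: vpos_ge0.
- by rewrite vpos_le vsumr_ge0// andbT vlerBlDr addrC.
exists (fun j => if j == i then vmeet y (x i) else y'' j); split.
  move=> j; case: eqVneq => [->|_]; last exact: y''x.
  by rewrite vle_meetr vmeet_ge0.
rewrite big_cons eqxx (eq_big_seq y''); last first.
  by move=> j js; case: eqVneq => // ji; rewrite -ji js in iNs.
by rewrite y''E vmeetE subrK.
Qed.

End modulus.

(** * Norm and order in a Banach lattice *)

Section banach_lattice.
Variables (R : realType) (E : banachLatticeType R).
Implicit Types (x y z : E).

Lemma norm_modulus_le x y : modulus x <=v y -> `|x| <= `|y|.
Proof.
move=> xy; apply: vle_modulus_norm; rewrite (vle_tran xy)//.
exact: vle_modulus.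
Qed.

Lemma norm_vle x y : 0 <=v x -> x <=v y -> `|x| <= `|y|.
Proof. by move=> x0 xy; apply: norm_modulus_le; rewrite modulus_id. Qed.

Lemma norm_modulus x : `|modulus x| = `|x|.
Proof.
apply/le_anti/andP; split; apply: vle_modulus_norm.
  by rewrite modulus_id ?vlexx// modulus_ge0.
by rewrite [modulus (modulus x)]modulus_id ?vlexx// modulus_ge0.
Qed.

Lemma norm_vpos x : `|vpos x| <= `|x|.
Proof. by rewrite -(norm_modulus x) norm_vle ?vpos_ge0 ?vpos_le_modulus. Qed.

(** Eventually [vpos (x - l)] is below [vpos (u n - l)], whose norm is at most the distance from
    [u n] to [l]. *)
Lemma vle_cvg_lim (u : nat -> E) (l x : E) :
  u @ \oo --> l -> (\forall n \near \oo, x <=v u n) -> x <=v l.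
Proof.
move=> ul xu; rewrite -vsubr_ge0.
suff : vpos (x - l) = 0.
  by move=> h; have := vle_pos (x - l); rewrite h -vlerN2 oppr0 opprB.
apply/eqP; rewrite -normr_le0; apply/ler_addgt0Pl => e e0; rewrite addr0.
have /cvgrPdist_le /(_ e e0) := ul => ule.
have [n [xn]] := filter_ex (filterI xu ule); rewrite distrC => /(le_trans _); apply.
apply: le_trans (norm_vpos _); apply: norm_vle; first exact: vpos_ge0.
by rewrite vpos_homo// vleD ?vlexx.
Qed.

End banach_lattice.

(** * Domination of positive bilinear forms *)

Section energy.
Variable (R : realType).

(** With [h] the common ratio, splitting raises the quotient by exactly the sum of the
    [(s_i - h t_i) ^+ 2 / t_i]; one of the two terms is kept. Division by [0] gives [0], harmlessly,
    since [t_i = 0] forces [s_i = 0]. *)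
Lemma sqr_div_increment (s1 t1 s2 t2 : R) :
  0 <= s1 <= t1 -> 0 <= s2 <= t2 ->
  (s1 - (s1 + s2) / (t1 + t2) * t1) ^+ 2 / t1 <=
  s1 ^+ 2 / t1 + s2 ^+ 2 / t2 - (s1 + s2) ^+ 2 / (t1 + t2).
Proof.
move=> /andP[s10 s1t1] /andP[s20 s2t2].
have [t10|t1n0] := eqVneq t1 0.
  have s1E : s1 = 0 by lra.
  by rewrite t10 s1E invr0 !mulr0 !add0r subrr.
have [t20|t2n0] := eqVneq t2 0.
  have s2E : s2 = 0 by lra.
  rewrite t20 s2E invr0 !mulr0 !addr0 mulfVK// !subrr.
  by rewrite expr0n/= mul0r.
have t1p : 0 < t1 by rewrite lt_def t1n0; lra.
have t2p : 0 < t2 by rewrite lt_def t2n0; lra.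
have tp : t1 + t2 != 0 by apply: lt0r_neq0; lra.
rewrite -subr_ge0.
have -> : s1 ^+ 2 / t1 + s2 ^+ 2 / t2 - (s1 + s2) ^+ 2 / (t1 + t2) -
    (s1 - (s1 + s2) / (t1 + t2) * t1) ^+ 2 / t1 =
    (s2 - (s1 + s2) / (t1 + t2) * t2) ^+ 2 / t2 by field; rewrite t2n0 t1n0 tp.
by rewrite divr_ge0 ?sqr_ge0 ?ltW.
Qed.

Lemma sqr_divD_le (s1 t1 s2 t2 : R) :
  0 <= s1 <= t1 -> 0 <= s2 <= t2 ->
  (s1 + s2) ^+ 2 / (t1 + t2) <= s1 ^+ 2 / t1 + s2 ^+ 2 / t2.
Proof.
move=> h1 h2; rewrite -subr_ge0; apply: le_trans (sqr_div_increment h1 h2).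
by rewrite divr_ge0 ?sqr_ge0//; lra.
Qed.

(** Cutting both arguments of a form gives four pieces. Convexity merges the last three, and
    [l * e <= e ^+ 2 / t + l ^+ 2 * t] turns the squared deviation of the first into an absolute
    one. *)
Lemma young_increment (l : R) (s1 t1 s2 t2 s3 t3 s4 t4 : R) : 0 <= l ->
  0 <= s1 <= t1 -> 0 <= s2 <= t2 -> 0 <= s3 <= t3 -> 0 <= s4 <= t4 ->
  l * `|s1 - (s1 + s2 + (s3 + s4)) / (t1 + t2 + (t3 + t4)) * t1| <=
  (s1 ^+ 2 / t1 + s2 ^+ 2 / t2 + (s3 ^+ 2 / t3 + s4 ^+ 2 / t4)
   - (s1 + s2 + (s3 + s4)) ^+ 2 / (t1 + t2 + (t3 + t4))) + l ^+ 2 * t1.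
Proof.
move=> l0 h1 h2 h3 h4.
have h34 : 0 <= s3 + s4 <= t3 + t4 by lra.
have h234 : 0 <= s2 + (s3 + s4) <= t2 + (t3 + t4) by lra.
have H1 := sqr_divD_le h3 h4.
have H2 := sqr_divD_le h2 h34.
have := sqr_div_increment h1 h234.
rewrite -![_ + _ + (_ + _)]addrA.
set d := s1 - _ => H3.
suff : l * `|d| <= d ^+ 2 / t1 + l ^+ 2 * t1 by lra.
have [t10|t1n0] := eqVneq t1 0.
  have s1E : s1 = 0 by lra.
  have -> : d = 0 by rewrite /d t10 s1E mulr0 subrr.
  by rewrite t10 normr0 !mulr0 invr0 mulr0 addr0.
have t1p : 0 < t1 by rewrite lt_def t1n0; lra.
rewrite -real_normK ?num_real//.
have e0 := normr_ge0 d; move: (`|d|) e0 => e e0.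
have : 0 <= (e - l * t1) ^+ 2 / t1 by rewrite divr_ge0 ?sqr_ge0 ?ltW.
have -> : (e - l * t1) ^+ 2 / t1 = e ^+ 2 / t1 + l ^+ 2 * t1 - 2 * (l * e).
  by field.
by have := mulr_ge0 l0 e0; lra.
Qed.

Variables (V W : zmodType) (P : V -> Prop) (Q : W -> Prop) (bS bT : V -> W -> R).
Hypothesis (P0 : P 0) (PD : forall u v, P u -> P v -> P (u + v)).
Hypothesis (Q0 : Q 0) (QD : forall u v, Q u -> Q v -> Q (u + v)).

(** The restriction to [P] and [Q] matters: later [W] consists of all functions from [F] to [R], and
    [g (A u)] is additive in [u] for linear [g], not for arbitrary ones. *)
Definition biadditive_on (b : V -> W -> R) : Prop :=
  (forall u v g, P u -> P v -> Q g -> b (u + v) g = b u g + b v g) /\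
  (forall u g k, P u -> Q g -> Q k -> b u (g + k) = b u g + b u k).

Hypothesis (bSD : biadditive_on bS) (bTD : biadditive_on bT).
Hypothesis (bST : forall u g, P u -> Q g -> 0 <= bS u g <= bT u g).

Lemma biadditive_on_sum (b : V -> W -> R) (I J : finType) (x : I -> V) (g : J -> W) :
  biadditive_on b -> (forall i, P (x i)) -> (forall j, Q (g j)) ->
  b (\sum_i x i) (\sum_j g j) = \sum_i \sum_j b (x i) (g j).
Proof.
move=> [bDl bDr] Px Qg.
have b0l k : Q k -> b 0 k = 0.
  by move=> Qk; have := bDl 0 0 k P0 P0 Qk; rewrite addr0; lra.
have b0r u : P u -> b u 0 = 0.
  by move=> Pu; have := bDr u 0 0 Pu Q0 Q0; rewrite addr0; lra.
have Psum : Q (\sum_j g j) by apply: big_ind.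
suff H : P (\sum_i x i) /\ b (\sum_i x i) (\sum_j g j) = \sum_i b (x i) (\sum_j g j).
  rewrite H.2; apply: eq_bigr => i _.
  suff : Q (\sum_j g j) /\ b (x i) (\sum_j g j) = \sum_j b (x i) (g j) by case.
  apply: (big_rec2 (fun u r => Q u /\ b (x i) u = r)); first by rewrite b0r.
  by move=> j u r _ [Qu <-]; rewrite bDr//; split => //; exact: QD.
apply: (big_rec2 (fun u r => P u /\ b u (\sum_j g j) = r)); first by rewrite b0l.
by move=> j u r _ [Pu <-]; rewrite bDl//; split => //; exact: PD.
Qed.

Definition energy (I J : finType) (x : I -> V) (g : J -> W) : R :=
  \sum_i \sum_j bS (x i) (g j) ^+ 2 / bT (x i) (g j).

Let split_fun (I : finType) (U : zmodType) (x y : I -> U) (p : I * bool) : U :=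
  if p.2 then y p.1 else x p.1 - y p.1.

Let sum_split (I : finType) (U : zmodType) (F : I -> bool -> U) :
  \sum_(p : I * bool) F p.1 p.2 = \sum_i (F i true + F i false).
Proof. by rewrite -pair_bigA/=; apply: eq_bigr => i _; rewrite big_bool. Qed.

(** Refining cuts every cell [(i, j)] into four. The scalar estimate is summed over the cells, and
    biadditivity adds the [bT (x i) (g j)] up to the value at the two sums. *)
Lemma energy_increment (l : R) (I J : finType) (x y : I -> V) (g q : J -> W) :
  0 <= l ->
  (forall i, P (y i) /\ P (x i - y i)) -> (forall j, Q (q j) /\ Q (g j - q j)) ->
  l * (\sum_i \sum_j `|bS (y i) (q j) -
         bS (x i) (g j) / bT (x i) (g j) * bT (y i) (q j)|) <=
  energy (split_fun x y) (split_fun g q) - energy x g +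
    l ^+ 2 * bT (\sum_i x i) (\sum_j g j).
Proof.
move=> l0 Py Qq.
have Px i : P (x i) by rewrite -(subrK (y i) (x i)); apply: PD; case: (Py i).
have Qg j : Q (g j) by rewrite -(subrK (q j) (g j)); apply: QD; case: (Qq j).
have bE b i j : biadditive_on b -> b (x i) (g j) =
    b (y i) (q j) + b (y i) (g j - q j) +
    (b (x i - y i) (q j) + b (x i - y i) (g j - q j)).
  move=> [bDl bDr]; have [Pyi Pxyi] := Py i; have [Qqj Qgqj] := Qq j.
  have := bDl _ _ _ Pxyi Pyi (Qg j).
  have := bDr _ _ _ Pyi Qgqj Qqj.
  have := bDr _ _ _ Pxyi Qgqj Qqj.
  by rewrite !subrK; lra.
pose e u k := bS u k ^+ 2 / bT u k.
have -> : energy (split_fun x y) (split_fun g q) = \sum_i \sum_j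
    (e (y i) (q j) + e (y i) (g j - q j) +
     (e (x i - y i) (q j) + e (x i - y i) (g j - q j))).
  rewrite /energy (sum_split (fun i b => \sum_(r : J * bool)
    e (if b then y i else x i - y i) (split_fun g q r))).
  apply: eq_bigr => i _.
  rewrite (sum_split (fun j c => e (y i) (if c then q j else g j - q j))).
  rewrite (sum_split (fun j c => e (x i - y i) (if c then q j else g j - q j))).
  by rewrite -big_split.
rewrite (biadditive_on_sum bTD Px Qg) /energy -sumrB !mulr_sumr -big_split/=.
apply: ler_sum => i _; rewrite -sumrB !mulr_sumr -big_split/=.
apply: ler_sum => j _; have [Pyi Pxyi] := Py i; have [Qqj Qgqj] := Qq j.
rewrite (bE bS)// (bE bT)//.
apply: le_trans (young_increment l0 _ _ _ _) _; rewrite ?bST//.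
rewrite lerD2l; apply: ler_wpM2l; first exact: sqr_ge0.
have := bST Pyi Qgqj; have := bST Pxyi Qqj; have := bST Pxyi Qgqj.
lra.
Qed.

(* The coefficients come from a pair of finite decompositions of [x0] and [g0]
   whose energy cannot be increased significantly by refining. *)
Lemma bilinear_domination (x0 : V) (g0 : W) (eps : R) : P x0 -> Q g0 -> 0 < eps ->
  exists (I J : finType) (x : I -> V) (g : J -> W) (h : I -> J -> R),
  [/\ \sum_i x i = x0 /\ \sum_j g j = g0,
      (forall i, P (x i)), (forall j, Q (g j)),
      (forall i j, 0 <= h i j <= 1) &
   forall (y : I -> V) (q : J -> W),
     (forall i, P (y i) /\ P (x i - y i)) -> (forall j, Q (q j) /\ Q (g j - q j)) ->
     `|bS (\sum_i y i) (\sum_j q j) - \sum_i \sum_j h i j * bT (y i) (q j)| <= eps].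
Proof.
move=> Px0 Qg0 eps0.
pose D : set R := [set r | exists (I J : finType) (x : I -> V) (g : J -> W),
  [/\ \sum_i x i = x0, \sum_j g j = g0, (forall i, P (x i)), (forall j, Q (g j)) &
   r = energy x g]].
have bst u k : P u -> Q k -> 0 <= bS u k ^+ 2 / bT u k <= bT u k.
  move=> Pu Qk; have /andP[s0 st] := bST Pu Qk.
  have t0 := le_trans s0 st.
  rewrite divr_ge0 ?sqr_ge0//=; have [->|tn0] := eqVneq (bT u k) 0.
    by rewrite invr0 mulr0.
  by rewrite ler_pdivrMr ?lt_def ?tn0// -expr2 lerXn2r.
(* Each term of an energy is at most [bT (x i) (g j)], since [0 <= bS <= bT]; hence [bT x0 g0]
   bounds all energies. *)
have Dsup : has_sup D.
  split.
    exists (energy (fun _ : unit => x0) (fun _ : unit => g0)).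
    exists unit, unit, (fun=> x0), (fun=> g0); split => //.
      by rewrite big_const card_unit/= addr0.
    by rewrite big_const card_unit/= addr0.
  exists (bT x0 g0) => _ [I [J [x [g [xx gg Px Qg ->]]]]].
  rewrite -xx -gg (biadditive_on_sum bTD)//.
  apply: ler_sum => i _; apply: ler_sum => j _.
  by case/andP: (bst _ _ (Px i) (Qg j)).
set B := bT x0 g0.
have B0 : 0 <= B by case/andP: (bST Px0 Qg0) => s0; exact: le_trans.
(* An energy within [l ^+ 2] of the supremum gains at most [l ^+ 2] by refinement, so the total
   deviation [s] satisfies [l * s <= l ^+ 2 + l ^+ 2 * B = l * eps]. *)
pose l := eps / (1 + B).
have l0 : 0 < l by rewrite divr_gt0//; lra.
have l2 : 0 < l ^+ 2 by rewrite exprn_gt0.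
have [_ [I [J [x [g [xx gg Px Qg ->]]]]] xgsup] := sup_adherent l2 Dsup.
exists I, J, x, g, (fun i j => bS (x i) (g j) / bT (x i) (g j)); split => //.
  move=> i j; have /andP[s0 st] := bST (Px i) (Qg j); have t0 := le_trans s0 st.
  rewrite divr_ge0//=; have [->|tn0] := eqVneq (bT (x i) (g j)) 0.
    by rewrite invr0 mulr0.
  by rewrite ler_pdivrMr ?lt_def ?tn0// mul1r.
move=> y q Py Qq.
have Pyi i : P (y i) by case: (Py i).
have Qqj j : Q (q j) by case: (Qq j).
have := energy_increment (ltW l0) Py Qq.
rewrite xx gg -/B => incr.
have Dsplit : D (energy (split_fun x y) (split_fun g q)).
  exists (I * bool)%type, (J * bool)%type, (split_fun x y), (split_fun g q).
  split => //.
  - rewrite (sum_split (fun i b => if b then y i else x i - y i)) -xx.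
    by apply: eq_bigr => i _; rewrite addrC subrK.
  - rewrite (sum_split (fun i b => if b then q i else g i - q i)) -gg.
    by apply: eq_bigr => i _; rewrite addrC subrK.
  - by move=> [i []] /=; case: (Py i).
  - by move=> [i []] /=; case: (Qq i).
have := sup_upper_bound Dsup Dsplit => Dle.
rewrite (biadditive_on_sum bSD)// -sumrB.
apply: le_trans (ler_norm_sum _ _ _) _.
set s := (X in l * X <= _) in incr.
have : l * s <= l * eps.
  apply: (le_trans incr).
  have -> : l * eps = l ^+ 2 + l ^+ 2 * B by rewrite /l; field; lra.
  by lra.
rewrite ler_pM2l//; apply: le_trans; apply: ler_sum => i _.
by rewrite -sumrB; exact: ler_norm_sum.
Qed.

End energy.

(** * Positive functionals *)

Lemma linear_ex (R : realType) (U V : lmodType R) (f : U -> V) :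
  linear f -> exists g : {linear U -> V}, forall u, g u = f u.
Proof.
move=> flin.
pose m := GRing.isLinear.Build _ _ _ _ f flin.
by exists (HB.pack_for {linear U -> V} f m).
Qed.

Section positive_functionals.
Variables (R : realType) (F : banachLatticeType R).
Implicit Types (phi psi : {linear F -> R^o}) (u v w : F).

Definition positive_functional phi : Prop := forall u, 0 <=v u -> 0 <= phi u.

Lemma positive_functional_le phi u v :
  positive_functional phi -> u <=v v -> phi u <= phi v.
Proof. by move=> p uv; rewrite -subr_ge0 -linearB p// vsubr_ge0. Qed.

Lemma positive_functional_norm phi v :
  positive_functional phi -> `|phi v| <= phi (modulus v).
Proof.
move=> p; rewrite ler_norml lerNl -linearN.
rewrite !positive_functional_le// ?vle_modulus//.
by rewrite -modulusN vle_modulus.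
Qed.

(* Jordan decomposition by Hahn-Banach: extending [(v, - v) |-> psi v] from the
   antidiagonal of [F * F], below [(v, w) |-> M * `|vpos v + vpos w|], writes [psi]
   as a difference of two positive functionals. *)
Lemma dominating_positive_functional psi (M : R) :
  0 <= M -> (forall v, psi v <= M * `|v|) ->
  exists phi, [/\ positive_functional phi,
    forall u, 0 <=v u -> `|psi u| <= phi u & forall u, phi u <= 2 * M * `|u|].
Proof.
move=> M0 psiM.
pose p (v : F * F) : R := M * `|vpos v.1 + vpos v.2|.
have sp : sublinear p.
  split=> [u v|a u a0]; rewrite /p /=.
    rewrite -mulrDr ler_wpM2l//; apply: le_trans (ler_normD _ _).
    apply: norm_vle; first by rewrite vaddr_ge0 ?vpos_ge0.
    by rewrite addrACA vleD ?vposD.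
  by rewrite !vposZ// -scalerDr normrZ ger0_norm// mulrCA.
have [L LE] : exists L : {linear F -> (F * F)%type}, forall v, L v = (v, - v).
  apply: linear_ex => a u v.
  by apply/pair_eqP; rewrite /= !eqxx /= opprD scalerN.
have [|G Gp GL] := @hahn_banach R F (F * F)%type p L psi sp.
  by move=> u; rewrite LE /p/= -modulusE norm_modulus.
have [phi phiE] : exists phi, forall v, phi v = G (v, v).
  apply: linear_ex => a u v.
  by rewrite -(linearP G).
have G0 v w : 0 <=v v -> 0 <=v w -> 0 <= G (v, w).
  move=> v0 w0; rewrite -oppr_le0 -linearN.
  by apply: (le_trans (Gp _)); rewrite /p/= !vpos_npos ?voppr_le0// addr0 normr0 mulr0.
exists phi; split.
- by move=> u u0; rewrite phiE G0.
- move=> u u0.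
  (* [phi] and [psi] are the sum and the difference of the two coordinate parts of [G], and these
     are positive. *)
  have e1 : phi u + psi u = G (u + u, 0).
    rewrite phiE -GL LE -linearD; congr (G _).
    by apply/pair_eqP; rewrite /= eqxx subrr /=.
  have e2 : phi u - psi u = G (0, u + u).
    rewrite phiE -GL LE -linearB; congr (G _).
    by apply/pair_eqP; rewrite /= opprK eqxx subrr /= eqxx.
  have := G0 (u + u) 0 (vaddr_ge0 u0 u0) (vlexx _).
  have := G0 0 (u + u) (vlexx _) (vaddr_ge0 u0 u0).
  by rewrite -e1 -e2 ler_norml => *; apply/andP; split; lra.
- move=> u; rewrite phiE; apply: (le_trans (Gp _)); rewrite /p/= -mulr2n normrMn.
  by have := ler_wpM2l M0 (norm_vpos u); rewrite mulrnAr -mulr_natl mulrA; lra.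
Qed.

(** Hahn-Banach below [v |-> phi (vpos v)], starting from the line through [w]. This bound vanishes
    on negative vectors and equals [phi] on positive ones, which forces [0 <= g <= phi] on the
    cone. *)
Lemma supporting_component phi w : positive_functional phi ->
  exists g, [/\ positive_functional g, forall u, 0 <=v u -> g u <= phi u &
    g w = phi (vpos w)].
Proof.
move=> phi0.
pose p (v : F) : R := phi (vpos v).
have sp : sublinear p.
  split=> [u v|a u a0]; rewrite /p /=.
    by rewrite -linearD positive_functional_le ?vposD.
  by rewrite vposZ// linearZ.
have [L LE] : exists L : {linear R^o -> F}, forall t : R, L t = t *: w.
  by apply: linear_ex => a u v; rewrite scalerDl scalerA.
have [f fE] : exists f : {linear R^o -> R^o}, forall t : R, f t = t * phi (vpos w).
  by apply: linear_ex => a u v; rewrite mulrDl -mulrA.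
have [|g gp gL] := @hahn_banach R R^o F p L f sp.
  move=> t; rewrite fE LE /p; have [t0|t0] := leP 0 t.
    by rewrite vposZ// linearZ.
  apply: (@le_trans _ _ 0); last by rewrite phi0 ?vpos_ge0.
  by rewrite mulr_le0_ge0 ?phi0 ?vpos_ge0 ?ltW.
exists g; split.
- move=> u u0; rewrite -oppr_le0 -linearN; apply: (le_trans (gp _)).
  by rewrite /p vpos_npos ?voppr_le0// linear0.
- by move=> u u0; apply: (le_trans (gp _)); rewrite /p vpos_id.
- by have := gL 1; rewrite LE fE scale1r mul1r.
Qed.

End positive_functionals.

(** For a filter [U], the image filter is Cauchy. Relative compactness is tested along ultrafilters
    in this form. *)
Definition cauchy_along (R : realType) (Y : Type) (Z : normedModType R)
    (U : set_system Y) (k : Y -> Z) : Prop :=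
  forall e : R, 0 < e ->
    exists2 D, U D & forall y y', D y -> D y' -> `|k y - k y'| <= e.

(** * Domination on an order interval *)

Section domination.
Variables (R : realType) (E F : banachLatticeType R) (S T : {linear E -> F}).
Hypotheses (S0 : positive_operator S) (ST : operator_le S T).

Let fpos (g : F -> R) : Prop :=
  exists2 G : {linear F -> R^o}, positive_functional G & g = G.

(** The forms are [g (S u)] and [g (T u)]. Splitting [k y] along the decomposition of [x] compares
    [S (k y)] with a combination of the [T (ki y i)], which are Cauchy; the hypothesis on [T] ranges
    over all [x'] and [k'] because it is applied to these pieces. *)
Lemma dominated_cauchy_along (phi : {linear F -> R^o}) (C : R) (Y : Type)
    (U : set_system Y) (x : E) (k : Y -> E) :
  Filter U -> positive_functional phi -> 0 <= C -> (forall v, phi v <= C * `|v|) ->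
  0 <=v x -> (forall y, 0 <=v k y /\ k y <=v x) ->
  (forall (x' : E) (k' : Y -> E), 0 <=v x' ->
     (forall y, 0 <=v k' y /\ k' y <=v x') -> cauchy_along U (T \o k')) ->
  forall e : R, 0 < e -> exists2 D, U D &
    forall y y', D y -> D y' -> phi (modulus (S (k y) - S (k y'))) <= e.
Proof.
move=> FU phi0 C0 phiC x0 kx Tc e e0.
pose bil (A : E -> F) (u : E) (g : F -> R) : R := g (A u).
have fpos0 : fpos 0.
  have [G GE] : exists G : {linear F -> R^o}, forall u, G u = 0.
    by apply: linear_ex => a u v; rewrite scaler0 addr0.
  by exists G; [move=> u _; rewrite GE|apply/funext => u; rewrite GE].
have fposD g h : fpos g -> fpos h -> fpos (g + h).
  move=> [G G0 ->] [H H0 ->].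
  have [K KE] : exists K : {linear F -> R^o}, forall u, K u = G u + H u.
    by apply: linear_ex => a u v; rewrite !linearP scalerDr addrACA.
  exists K; first by move=> u u0; rewrite KE addr_ge0 ?G0 ?H0.
  by apply/funext => u; rewrite KE.
have bilD (A : {linear E -> F}) : biadditive_on (fun u : E => 0 <=v u) fpos (bil A).
  split=> // u v g _ _ [G G0 ->]; rewrite /bil !linearD.
  by [].
have bilST u g : 0 <=v u -> fpos g -> 0 <= bil S u g <= bil T u g.
  move=> u0 [G G0 ->]; rewrite /bil G0 ?S0//=.
  by rewrite positive_functional_le// ST.
(* Two approximations and one comparison under [T] cost [e / 8] each, within [e / 2] for either of
   the positive and negative parts. *)
have e4 : 0 < e / 8 by lra.
have [I [J [xi [g [h [[xiE gE] xi0 g0 h01 approx]]]]]] :=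
  bilinear_domination (vlexx 0) (@vaddr_ge0 _ E) fpos0 fposD (bilD S) (bilD T)
    bilST x0 (ex_intro2 _ _ phi phi0 erefl) e4.
have /choice [ki kiE] : forall y, exists k' : I -> E,
    (forall i, 0 <=v k' i /\ k' i <=v xi i) /\ \sum_i k' i = k y.
  move=> y; case: (kx y) => ky0 kyx.
  by apply: riesz_decomposition; rewrite ?xiE.
(* Makes [#|I| * C * d] at most [e / 8]; the summand [1] keeps the denominator positive. *)
pose d := e / (8 * (#|I|%:R * C + 1)).
have IC0 : 0 <= #|I|%:R * C :> R by rewrite mulr_ge0.
have d0 : 0 < d by rewrite divr_gt0//; lra.
have /choice [D DP] : forall i, exists D, U D /\
    forall y y', D y -> D y' -> `|T (ki y i) - T (ki y' i)| <= d.
  move=> i.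
  have kib y : 0 <=v ki y i /\ ki y i <=v xi i by case: (kiE y) => /(_ i).
  have [D UD DE] := Tc (xi i) (fun y => ki y i) (xi0 i) kib d d0.
  by exists D.
exists [set y | forall i, D i y].
  by apply: filter_forall => i; case: (DP i).
have half y y' : (forall i, D i y) -> (forall i, D i y') ->
    phi (vpos (S (k y) - S (k y'))) <= e / 2.
  move=> Dy Dy'; set w := S (k y) - S (k y').
  (* These functionals depend on [y] and [y']; this is allowed because [approx] is uniform in [q],
     while the decompositions and [D] are already fixed. *)
  have /choice [q qP] : forall j, exists q : {linear F -> R^o},
      [/\ positive_functional q, forall u, 0 <=v u -> q u <= g j u &
          q w = g j (vpos w)].
    by move=> j; have [G G0 ->] := g0 j; exact: supporting_component.
  pose qs (j : J) : F -> R := q j.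
  have qsP j : fpos (qs j) /\ fpos (g j - qs j).
    case: (qP j) => q0 qg _; split; first by exists (q j).
    have [G G0 gjE] := g0 j.
    have [K KE] : exists K : {linear F -> R^o}, forall u, K u = G u - q j u.
      by apply: linear_ex => a u v; rewrite !linearP /GRing.scale/=; ring.
    exists K; first by move=> u u0; rewrite KE subr_ge0 -gjE qg.
    by apply/funext => u; rewrite KE gjE.
  have kiP z : forall i, 0 <=v ki z i /\ 0 <=v xi i - ki z i.
    by move=> i; case: (kiE z) => /(_ i)[h1 h2] _; rewrite vsubr_ge0.
  have := approx _ _ (kiP y) qsP; have := approx _ _ (kiP y') qsP.
  case: (kiE y) => _ ->; case: (kiE y') => _ ->.
  rewrite /bil !fct_sumE => ay' ay.
  have -> : phi (vpos w) = \sum_j qs j (S (k y)) - \sum_j qs j (S (k y')).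
    rewrite -sumrB -gE fct_sumE; apply: eq_bigr => j _.
    by rewrite /qs -linearB; case: (qP j).
  have diff : `|\sum_i \sum_j h i j * qs j (T (ki y i)) -
                \sum_i \sum_j h i j * qs j (T (ki y' i))| <= e / 8.
    rewrite -sumrB; apply: le_trans (ler_norm_sum _ _ _) _.
    apply: (@le_trans _ _ (\sum_(i : I) C * d)).
      apply: ler_sum => i _; rewrite -sumrB.
      pose v := T (ki y i) - T (ki y' i).
      apply: le_trans (ler_norm_sum _ _ _) _.
      (* As [q j <= g j] and the [g j] sum to [phi], the sum over [J] costs only [phi (modulus v)],
         whatever the size of [J]. *)
      apply: (@le_trans _ _ (phi (modulus v))).
        rewrite -gE fct_sumE; apply: ler_sum => j _.
        rewrite -mulrBr -linearB -/v normrM.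
        have /andP[hij0 hij1] := h01 i j.
        rewrite ger0_norm//; have [q0 qg _] := qP j.
        apply: (@le_trans _ _ (1 * `|q j v|)); first exact: ler_wpM2r.
        rewrite mul1r; apply: le_trans (positive_functional_norm _ q0) _.
        by rewrite qg ?modulus_ge0.
      apply: le_trans (phiC _) _; rewrite norm_modulus ler_wpM2l//.
      by case: (DP i) => _; apply; [exact: Dy|exact: Dy'].
    rewrite sumr_const -[leLHS]mulr_natl mulrA /d.
    move: (#|I|%:R * C) IC0 => n n0.
    have -> : n * (e / (8 * (n + 1))) = e / 8 * (n / (n + 1)) by field; lra.
    by rewrite ler_piMr ?ler_pdivrMr//; lra.
  move: ay ay' diff; rewrite !ler_norml => /andP[ay1 ay2] /andP[ay1' ay2'] /andP[d1 d2].
  lra.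
move=> y y' Dy Dy'; rewrite modulusE linearD opprB.
by have := half _ _ Dy Dy'; have := half _ _ Dy' Dy; lra.
Qed.

End domination.

(** * Ultrafilters and weak compactness *)

Section ultrafilters.

Lemma fmap_ultra (Y Z : Type) (U : set_system Y) (k : Y -> Z) :
  UltraFilter U -> UltraFilter (k @ U).
Proof.
move=> UU; have PU : ProperFilter U by exact: ultra_proper.
split; first exact: fmap_proper_filter.
move=> G GF UG; apply/seteqP; split => // B GB.
have [//|UnB] := in_ultra_setVsetC (k @^-1` B) UU.
have GnB : G (~` B) by apply: UG.
by have [z []] := filter_ex (filterI GB GnB).
Qed.

Lemma ultra_nat_ex : exists2 U : set_system nat, UltraFilter U & \oo `<=` U.
Proof. by have [U [UU oU]] := ultraFilterLemma eventually_filter; exists U. Qed.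

Variable R : realType.

Lemma bounded_ultra_cvg (Y : Type) (U : set_system Y) (a : Y -> R) (M : R) :
  UltraFilter U -> (forall y, `|a y| <= M) -> exists l : R, a @ U --> l.
Proof.
move=> UU aM; have PU : ProperFilter U by exact: ultra_proper.
have Ua : (a @ U) [set` `[- M, M]].
  by apply: (@filterE _ U) => y; rewrite /= in_itv/= -ler_norml.
have := @segment_compact R (- M) M.
by rewrite compact_ultra => /(_ _ (fmap_ultra a UU) Ua)[l [_ al]]; exists l.
Qed.

End ultrafilters.

(** * The weak topology *)

Section weak_topology.
Variables (R : realType) (X : normedModType R).

Lemma weak_cvgE (F : set_system X) (x : X) : Filter F ->
  (F --> (x : weak_type X)) <->
  (forall f : continuous_dual X, (sval f : X -> R^o) @ F --> (sval f x : R^o)).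
Proof.
move=> FF; rewrite (@cvg_sup X (continuous_dual X)); split => H f.
  have Hf := H f.
  apply: cvg_trans (@initial_continuous X R^o (sval f) x) => /=.
  exact: cvg_app Hf.
move=> A; rewrite nbhsE => -[B [[C oC <-] Cx] BA].
have : nbhs (sval f x : R^o) C by apply: open_nbhs_nbhs.
move=> /(H f) FC; apply: (@filterS _ F FF _ _ _ FC) => y Cy; exact: BA.
Qed.

(** A single [K] containing its own limits allows weak limits to be taken repeatedly, also of points
    of [K] outside [B]. *)
Lemma weakly_compact_ultra (B : set X) : relatively_weakly_compact B ->
  exists2 K : set X, B `<=` K &
    forall (Y : Type) (U : set_system Y) (k : Y -> X), UltraFilter U ->
      (forall y, K (k y)) ->
      exists2 x, K x & forall f : continuous_dual X,
        (fun y => sval f (k y) : R^o) @ U --> (sval f x : R^o).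
Proof.
move=> [K BK [Kc _]]; exists K => // Y U k UU Kk.
have := Kc; rewrite compact_ultra => /(_ _ (fmap_ultra k UU))[].
  exact: (@filterE _ U).
move=> x [Kx kx]; exists x => // f.
by have /(weak_cvgE _ _) := kx; apply.
Qed.

Lemma dual_ex (f : {linear X -> R^o}) (M : R) :
  (forall u, `|f u| <= M * `|u|) -> exists g : continuous_dual X, sval g = f.
Proof.
move=> fM.
suff fc : continuous f by exists (exist _ f fc).
apply/linear_bounded_continuous/linear_boundedP.
apply: filterS (nbhs_pinfty_ge (num_real M)) => r Mr u.
by apply: le_trans (fM u) _; apply: ler_wpM2r.
Qed.

Lemma norming_functional (x : X) : exists2 f : continuous_dual X,
  (forall u, `|sval f u| <= `|u|) & sval f x = `|x|.
Proof.
have sp : sublinear (fun u : X => `|u|).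
  by split=> [u v|a u a0]; [exact: ler_normD|rewrite normrZ ger0_norm].
have [L LE] : exists L : {linear R^o -> X}, forall t : R, L t = t *: x.
  by apply: linear_ex => a u v; rewrite scalerDl scalerA.
have [f fE] : exists f : {linear R^o -> R^o}, forall t : R, f t = t * `|x|.
  by apply: linear_ex => a u v; rewrite mulrDl -mulrA.
have [|g gp gL] := @hahn_banach R R^o X _ L f sp.
  by move=> t; rewrite fE LE normrZ ler_wpM2r// ler_norm.
have gle u : `|g u| <= `|u|.
  by rewrite ler_norml gp andbT lerNl -linearN -normrN.
have [|G GE] := @dual_ex g 1; first by move=> u; rewrite mul1r.
exists G; rewrite GE //.
by have := gL 1; rewrite LE fE scale1r mul1r.
Qed.

Lemma bounded_fun_norm_linear (Z : normedModType R) (f : {linear X -> Z}) :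
  bounded_fun_norm f -> exists2 M, 0 <= M & forall u, `|f u| <= M * `|u|.
Proof.
move=> /bounded_funP/linear_boundedP fr.
have [M [fM M0]] := filter_ex (filterI fr (nbhs_pinfty_ge (num_real (0 : R)))).
by exists M.
Qed.

Lemma continuous_dual_bounded (f : continuous_dual X) :
  exists2 M, 0 <= M & forall u, `|sval f u| <= M * `|u|.
Proof.
case: f => f fc; apply: bounded_fun_norm_linear; apply/bounded_funP.
exact/linear_bounded_continuous.
Qed.

End weak_topology.

(** * Precompactness through ultrafilters *)

Section cauchy.
Variables (R : realType) (Y : Type).

Lemma precompact_cauchy_along (Z : normedModType R) (B : set Z)
    (U : set_system Y) (k : Y -> Z) :
  precompact B -> UltraFilter U -> U (k @^-1` B) -> cauchy_along U k.
Proof.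
move=> [K BK [Kc _]] UU UB e e0; move: Kc; rewrite compact_ultra.
move=> /(_ _ (fmap_ultra k UU))[].
  by apply: filterS UB => y; exact: BK.
move=> l [_ /cvgrPdist_le/(_ (e / 2))]; rewrite divr_gt0// => /(_ isT) h.
exists [set y | `|l - k y| <= e / 2] => //.
move=> y y' /= h1 h2; apply: le_trans (ler_distD l _ _) _.
by rewrite distrC; lra.
Qed.

Lemma cauchy_along_precompact (Z : completeNormedModType R) (A : set Y) (k : Y -> Z) :
  (forall U : set_system Y, UltraFilter U -> U A -> cauchy_along U k) ->
  precompact (k @` A).
Proof.
move=> kA; rewrite precompactE => F FF FK.
(* [F] lives on the closure of the image of [A], so its sets are thickened by [e] before being
   pulled back to [A]. The image of an ultrafilter above [G0] converges by completeness, and its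
   limit is a cluster point of [F]. *)
pose G0 := [set D : set Y | exists C e, [/\ F C, 0 < e &
  [set y | A y /\ exists2 z, C z & `|k y - z| < e] `<=` D]].
have G0P : ProperFilter G0.
  split.
    move=> [C [e [FC e0 sub]]].
    have [z [Cz Kz]] := filter_ex (filterI FC FK).
    have [_ [[y Ay <-] zy]] := Kz _ (nbhsx_ballx z e e0).
    apply: (sub y); split => //; exists z => //.
    by move: zy; rewrite -ball_normE /= distrC.
  split.
  - by exists setT, 1; split => //; exact: filterT.
  - move=> D D' [C [e [FC e0 sub]]] [C' [e' [FC' e0' sub']]].
    exists (C `&` C'), (Num.min e e'); split.
    + exact: filterI.
    + by rewrite lt_min e0.
    + move=> y [Ay [z [Cz C'z]]]; rewrite lt_min => /andP[h h'].
      by split; [apply: sub|apply: sub']; split => //; exists z.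
  - move=> D D' DD' [C [e [FC e0 sub]]]; exists C, e; split => //.
    exact: subset_trans DD'.
have [U [UU GU]] := ultraFilterLemma G0P.
have UA : U A.
  apply: GU; exists setT, 1; split => //; first exact: filterT.
  by move=> y [].
have kU : cauchy (k @ U).
  apply: cauchy_exP => e e0.
  have e20 : 0 < e / 2 by rewrite divr_gt0.
  have [D UD kD] := kA U UU UA _ e20.
  have [y Dy] := filter_ex UD; exists (k y).
  apply: (@filterS _ U _ _ _ _ UD) => y' Dy'; rewrite -ball_normE /=.
  by apply: le_lt_trans (kD _ _ Dy Dy') _; lra.
have /cvg_ex[l kl] : cvg (k @ U) by exact: cauchy_cvg.
exists l; split.
  apply: (closed_cvg _ (@closed_closure _ _) _ _ kl).
  by apply: (@filterS _ U _ _ _ _ UA) => y Ay; apply: subset_closure; exists y.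
move=> C B FC /nbhs_ballP[e /= e0 eB].
have e20 : 0 < e / 2 by rewrite divr_gt0.
have UC : U [set y | A y /\ exists2 z, C z & `|k y - z| < e / 2].
  by apply: GU; exists C, (e / 2); split.
have /cvgrPdist_lt/(_ _ e20) Ul := kl.
have [y [[Ay [z Cz yz]] ly]] := filter_ex (filterI UC Ul).
exists z; split => //; apply: eB; rewrite -ball_normE /=.
by apply: le_lt_trans (ler_distD (k y) _ _) _; move: yz ly => /=; lra.
Qed.

End cauchy.

(** * Order weakly compact operators *)

(** Dependent choice whose state is the list of all earlier terms. *)
Lemma dependent_sequence (T : Type) (P : seq T -> T -> Prop) :
  (forall s, exists t, P s t) -> exists u : nat -> T, forall n, P (mkseq u n) (u n).
Proof.
move=> /choice[next nextP].
pose L := fix L n := if n is n'.+1 then rcons (L n') (next (L n')) else [::].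
exists (fun n => next (L n)) => n.
suff -> : mkseq (fun n => next (L n)) n = L n by exact: nextP.
by elim: n => // n IH; rewrite mkseqS IH.
Qed.

(** * Excesses over iterated joins *)

Section iterated_joins.
Variables (R : realType) (F : vectorLatticeType R) (w : nat -> F) (z : F).
Hypothesis (wz : forall n, 0 <=v w n /\ w n <=v z).

Fixpoint join_from (n k : nat) : F :=
  if k is k'.+1 then vjoin (w n) (join_from n.+1 k') else 0.

(* [excess n N] is the positive part of [w n] minus the join of the [w k], [n < k < N];
   as a difference of joins it telescopes. *)
Definition excess (n N : nat) : F :=
  join_from n (N - n) - join_from n.+1 (N - n.+1).

Lemma join_from_bounds n k : 0 <=v join_from n k /\ join_from n k <=v z.
Proof.
have [w0 w0z] := wz 0.
elim: k n => [|k IH] n /=; first by split; [exact: vlexx|exact: vle_tran w0z].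
have [r0 rz] := IH n.+1; have [wn0 wnz] := wz n.
by rewrite vle_join wnz rz (vle_tran wn0 (vle_joinl _ _)).
Qed.

Lemma join_from_sum n k : join_from n k <=v \sum_(n <= i < n + k) w i.
Proof.
elim: k n => [|k IH] n /=; first by rewrite addn0 big_geq// vlexx.
have S0 m p : 0 <=v \sum_(m <= i < p) w i.
  by apply: vsumr_ge0 => i _; case: (wz i).
rewrite addnS big_ltn ?ltnS ?leq_addr// vle_join vlerDl//= -addSn.
by apply: vle_tran (IH n.+1) _; rewrite addrC vlerDl//; case: (wz n).
Qed.

Lemma excess_gt n N : (N <= n)%N -> excess n N = 0.
Proof.
move=> Nn; rewrite /excess; have /eqP-> : (N - n == 0)%N by rewrite subn_eq0.
have /eqP-> /= : (N - n.+1 == 0)%N by rewrite subn_eq0 leqW.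
by rewrite subrr.
Qed.

Lemma excess_lt n N : (n < N)%N ->
  excess n N = vpos (w n - join_from n.+1 (N - n.+1)).
Proof.
by move=> nN; rewrite /excess -[(N - n)%N]subSS subSn//= vjoinE addrC addrA addNr add0r.
Qed.

Lemma excess_bounds n N : 0 <=v excess n N /\ excess n N <=v w n.
Proof.
have [wn0 wnz] := wz n; case: (leqP N n) => nN.
  by rewrite excess_gt// vlexx.
rewrite excess_lt// vpos_ge0; split=> //.
by rewrite vpos_le wn0 andbT vlerBlDr vlerDl//; case: (join_from_bounds n.+1 (N - n.+1)).
Qed.

(** What is removed from [w n] is at most the join of the later terms, hence at most their sum. *)
Lemma excess_approx n N : (n < N)%N ->
  w n - excess n N <=v \sum_(n.+1 <= i < N) w i.
Proof.
move=> nN; rewrite excess_lt//.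
have := join_from_sum n.+1 (N - n.+1); rewrite subnKC//; apply: vle_tran.
by rewrite vlerBlDr addrC -vlerBlDr vle_pos.
Qed.

Lemma join_from_homo n m N : (n <= m)%N -> join_from m (N - m) <=v join_from n (N - n).
Proof.
move=> /subnKC <-; elim: (m - n)%N => [|k IH]; first by rewrite addn0 vlexx.
apply: vle_tran IH; rewrite addnS -vsubr_ge0.
by case: (excess_bounds (n + k) N).
Qed.

(** Each excess is the drop of [join_from] over one step. Along a subsequence the drops telescope,
    and the skipped steps only help because [join_from] decreases with its starting index. *)
Lemma sum_excess_le (nu : nat -> nat) m N :
  (forall i, (nu i < nu i.+1)%N) -> \sum_(i < m) excess (nu i) N <=v z.
Proof.
move=> nuS.
suff : \sum_(i < m) excess (nu i) N + join_from (nu m) (N - nu m)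
    <=v join_from (nu 0) (N - nu 0).
  move=> h; apply: vle_tran (join_from_bounds (nu 0) (N - nu 0)).2.
  by apply: vle_tran h; rewrite vlerDl//; case: (join_from_bounds (nu m) (N - nu m)).
elim: m => [|m IH]; first by rewrite big_ord0 add0r vlexx.
rewrite big_ord_recr /=; apply: vle_tran IH.
rewrite -addrA vleD ?vlexx// /excess -[X in _ <=v X]addr0 -addrA vleD ?vlexx//.
by rewrite addrC -[X in _ <=v X](subrr (join_from (nu m).+1 (N - (nu m).+1))) vlerD2r
  join_from_homo.
Qed.

End iterated_joins.

Lemma geometric_tail_le (R : realType) (j m : nat) :
  \sum_(j.+1 <= i < m) 2^-1 ^+ i <= 2^-1 ^+ j :> R.
Proof.
have g0 n : 0 <= 2^-1 ^+ n :> R by rewrite exprn_ge0.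
have [mj|/ltnW/subnKC <-] := leqP m j.+1; first by rewrite big_geq.
suff : \sum_(j.+1 <= i < j.+1 + (m - j.+1)) 2^-1 ^+ i + 2^-1 ^+ (j + (m - j.+1))
    = 2^-1 ^+ j :> R.
  by have := g0 (j + (m - j.+1))%N; lra.
elim: (m - j.+1)%N => [|k IH]; first by rewrite !addn0 big_geq// add0r.
rewrite addnS big_nat_recr ?leq_addr//= -[RHS]IH addSn addnS exprS.
by move: (\sum_(_ <= _ < _) _) (_ ^+ _) => a b; lra.
Qed.

Lemma sum_split_at (V : zmodType) (G : nat -> V) (j m : nat) : (j < m)%N ->
  \sum_(i < m) G i = \sum_(i < j) G i + (G j + \sum_(j.+1 <= i < m) G i).
Proof.
move=> jm; rewrite -(big_mkord xpredT G) (big_cat_nat (leq0n j) (ltnW jm)).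
by rewrite (big_ltn jm) big_mkord.
Qed.

(** * Control of the operator by one positive functional *)

Section order_weakly_compact_domination.
Variables (R : realType) (F : banachLatticeType R) (X : completeNormedModType R).
Variables (S : {linear F -> X}) (z : F).
Hypothesis Swc : relatively_weakly_compact (S @` [set u | 0 <=v u /\ u <=v z]).

(* The excesses of the [w n] sum to at most [z], so weak limits [c n] of their images
   exist along an ultrafilter, and so does a weak sum [x] of a subsequence.  Along the
   subsequence the values [f j (c i)], [i < j], are close to their limits [a i], those
   with [i > j] are negligible and [f j (c j)] is at least about [e]; hence the limit
   of [f j x] exceeds by [e] its own value, the sum of the [a i]. *)
Lemma no_concentrated_sequence (w : nat -> F) (f : nat -> continuous_dual X)
    (phi : nat -> {linear F -> R^o}) (e : R) :
  0 < e -> (forall n, 0 <=v w n /\ w n <=v z) ->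
  (forall n u, `|sval (f n) u| <= `|u|) ->
  (forall n, positive_functional (phi n)) ->
  (forall n u, 0 <=v u -> `|sval (f n) (S u)| <= phi n u) ->
  (forall n k, (n < k)%N -> phi n (w k) <= 2^-1 ^+ k) ->
  (forall n, e <= sval (f n) (S (w n))) -> False.
Proof.
move=> e0 wz f1 phi0 fphi phiw few.
have [U UU oU] := ultra_nat_ex.
have PU : ProperFilter U by exact: ultra_proper.
have [K SK Kultra] := weakly_compact_ultra Swc.
have dP n N := excess_bounds wz n N.
have KS u : 0 <=v u -> u <=v z -> K (S u) by move=> u0 uz; apply: SK; exists u.
have /choice[c cP] : forall n, exists c, forall g : continuous_dual X,
    (fun N => sval g (S (excess w n N)) : R^o) @ U --> (sval g c : R^o).
  move=> n; have [|c _ cE] := Kultra _ U (fun N => S (excess w n N)) UU.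
    move=> N; have [d0 dw] := dP n N; apply: KS => //.
    by apply: vle_tran dw _; case: (wz n).
  by exists c.
(* The excess differs from [w n] by at most the sum of the later [w i], on which [phi n] is at most
   the geometric tail. *)
have fc_ge n : e - 2^-1 ^+ n <= sval (f n) (c n).
  apply: (cvgr_to_ge (cP n (f n))); apply: oU; exists n.+1 => // N /= nN.
  have -> : sval (f n) (S (excess w n N)) =
      sval (f n) (S (w n)) - sval (f n) (S (w n - excess w n N)).
    by rewrite -!linearB subKr.
  have [d0 dw] := dP n N.
  apply: lerB => //; apply: le_trans (ler_norm _) _.
  apply: le_trans (fphi n _ _) _; first by rewrite vsubr_ge0.
  apply: le_trans (positive_functional_le (phi0 n) (excess_approx wz nN)) _.
  rewrite linear_sum; apply: le_trans (geometric_tail_le R n N).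
  by apply: ler_sum_nat => i /andP[ni _]; exact: phiw.
have fc_tail n k : (n < k)%N -> - 2^-1 ^+ k <= sval (f n) (c k).
  move=> nk; apply: (cvgr_to_ge (cP k (f n))); apply: nearW => N.
  have [d0 dw] := dP k N.
  rewrite lerNl; apply: le_trans (ler_norm _) _; rewrite normrN.
  apply: le_trans (fphi n _ d0) _.
  exact: le_trans (positive_functional_le (phi0 n) dw) (phiw _ _ nk).
have /choice[a aP] : forall n, exists a : R,
    (fun j => sval (f j) (c n)) @ U --> a.
  by move=> n; apply: (@bounded_ultra_cvg R _ U _ `|c n| UU) => j; exact: f1.
(* Each new index exceeds the earlier ones and brings its functional within [2^-n], in total, of the
   limits [a i] on the earlier [c i]. *)
have [nu nuP] : exists nu : nat -> nat, forall n,
    (forall i, i \in mkseq nu n -> (i < nu n)%N) /\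
    \sum_(i <- mkseq nu n) `|sval (f (nu n)) (c i) - a i| <=
      2^-1 ^+ size (mkseq nu n).
  apply: (@dependent_sequence nat (fun s t => (forall i, i \in s -> (i < t)%N) /\
    \sum_(i <- s) `|sval (f t) (c i) - a i| <= 2^-1 ^+ size s)) => s.
  have gs : 0 < 2^-1 ^+ size s :> R by rewrite exprn_gt0.
  have : (fun t => \sum_(i <- s) `|sval (f t) (c i) - a i|) @ U --> (0 : R).
    rewrite -[X in _ --> X](@big1_eq R 0 +%R _ s xpredT).
    apply: cvg_big => [|i _]; first exact: add_continuous.
    rewrite -(normr0 R) -(subrr (a i)); apply: cvg_norm.
    by apply: cvgB; [exact: aP|exact: cvg_cst].
  move=> /cvgrPdist_le/(_ _ gs) Us.
  have Ubig : U [set t | (\max_(i <- s) i < t)%N].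
    by apply: oU; exists (\max_(i <- s) i).+1.
  have [t /= [ts st]] := filter_ex (filterI Us Ubig); exists t; split.
    move=> i si; apply: leq_ltn_trans st.
    by rewrite (big_rem i)//= leq_maxl.
  by move: ts; rewrite sub0r normrN; apply: le_trans; exact: ler_norm.
have nu_lt i j : (i < j)%N -> (nu i < nu j)%N.
  move=> ij; case: (nuP j) => h _; apply: h.
  by rewrite /mkseq map_f// mem_iota.
have nu_ge j : (j <= nu j)%N.
  by elim: j => // j IH; apply: leq_ltn_trans IH _; exact: nu_lt.
have nuS i : (nu i < nu i.+1)%N by exact: nu_lt.
have nu_approx j : \sum_(i < j) `|sval (f (nu j)) (c (nu i)) - a (nu i)| <= 2^-1 ^+ j.
  rewrite -(big_mkord xpredT (fun i => `|sval (f (nu j)) (c (nu i)) - a (nu i)|)).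
  by case: (nuP j) => _; rewrite /mkseq big_map size_map size_iota /index_iota subn0.
have g_le i j : (i <= j)%N -> 2^-1 ^+ j <= 2^-1 ^+ i :> R.
  by move=> ij; apply: ler_wiXn2l => //; lra.
(* The finite sums of the [c (nu i)] are represented in [K], because the sums of the excesses
   themselves stay in the interval from [0] to [z]. *)
have /choice[p pP] : forall m, exists p, K p /\ forall g : continuous_dual X,
    sval g p = \sum_(i < m) sval g (c (nu i)).
  move=> m.
  have [|p Kp pE] := Kultra _ U (fun N => S (\sum_(i < m) excess w (nu i) N)) UU.
    move=> N; apply: KS; last exact: sum_excess_le.
    by apply: vsumr_ge0 => i _; case: (dP (nu i) N).
  exists p; split=> // g; apply: (norm_cvg_unique (pE g)).
  rewrite (_ : (fun N => _) =
      (fun N => \sum_(i < m) (sval g (S (excess w (nu i) N)) : R^o))); last first.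
    by apply/funext => N; rewrite !linear_sum.
  by apply: cvg_big => [|i _]; [exact: add_continuous|exact: cP].
have [|x _ xP] := Kultra _ U p UU; first by move=> m; case: (pP m).
have [h hP] : exists h : continuous_dual X, forall u,
    (fun j => sval (f (nu j)) u) @ U --> sval h u.
  have /choice[h hE] : forall u, exists l : R, (fun j => sval (f (nu j)) u) @ U --> l.
    by move=> u; apply: (@bounded_ultra_cvg R _ U _ `|u| UU) => j; exact: f1.
  have [H HE] : exists H : {linear X -> R^o}, forall u, H u = h u.
    apply: linear_ex => t u v; apply: (norm_cvg_unique (hE _)) => //.
    rewrite (_ : (fun j => _) =
      (fun j => t * sval (f (nu j)) u + sval (f (nu j)) v)); last first.
      by apply/funext => j; rewrite linearP.
    by apply: cvgD (hE v); apply: cvgM (hE u); exact: cvg_cst.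
  have [|G GE] := @dual_ex R X H 1.
    move=> u; rewrite mul1r HE.
    by apply: (cvgr_to_le (cvg_norm (hE u))); apply: nearW => j; exact: f1.
  by exists G => u; rewrite GE HE.
have g_cvg : (fun j : nat => 2^-1 ^+ j : R) @ U --> (0 : R).
  have half : `|2^-1 : R| < 1 by rewrite ger0_norm; lra.
  by move=> A /(cvg_expr half) oA; exact: oU.
(* [a] is a limit over all [f j], whereas [h] is a limit over the [f (nu j)]; [nu_approx] makes the
   two agree. *)
have ha i : sval h (c (nu i)) = a (nu i).
  apply: (norm_cvg_unique (hP _)).
  apply/cvgrPdist_le => d d0.
  have /cvgrPdist_le/(_ _ d0) Ug := g_cvg.
  have Ui : U [set j | (i < j)%N] by apply: oU; exists i.+1.
  apply: filterS (filterI Ug Ui) => j /= [gd ij].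
  rewrite sub0r normrN in gd; rewrite distrC.
  apply: le_trans (le_trans (ler_norm _) gd); apply: le_trans (nu_approx j).
  rewrite (bigD1 (Ordinal ij))//= lerDl sumr_ge0//.
pose s m := \sum_(i < m) a (nu i).
have hp m : sval h (p m) = s m.
  by case: (pP m) => _ ->; apply: eq_bigr => i _; exact: ha.
have s_cvg : s @ U --> sval h x.
  have := xP h; rewrite (_ : (fun m => _) = s)//.
  by apply/funext => m; exact: hp.
(* The terms before, at and after [j] each lose at most [2^-j], whence the factor [3]. *)
have fp_ge j m : (j < m)%N -> s j + e - 3 * 2^-1 ^+ j <= sval (f (nu j)) (p m).
  move=> jm; case: (pP m) => _ ->.
  rewrite (sum_split_at (fun i => sval (f (nu j)) (c (nu i))) jm).
  have h1 : s j - 2^-1 ^+ j <= \sum_(i < j) sval (f (nu j)) (c (nu i)).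
    have := nu_approx j; rewrite /s => happ.
    rewrite lerBlDr -lerBlDl; apply: le_trans happ.
    rewrite -sumrB; apply: ler_sum => i _.
    by rewrite distrC; exact: ler_norm.
  have h2 : e - 2^-1 ^+ j <= sval (f (nu j)) (c (nu j)).
    apply: le_trans (fc_ge _); rewrite lerD2l lerN2; exact/g_le/nu_ge.
  have h3 : - 2^-1 ^+ j <= \sum_(j.+1 <= i < m) sval (f (nu j)) (c (nu i)).
    apply: (@le_trans _ _ (\sum_(j.+1 <= i < m) - 2^-1 ^+ i)).
      by rewrite sumrN lerN2 geometric_tail_le.
    apply: ler_sum_nat => i /andP[ji _].
    apply: le_trans (fc_tail _ _ (nu_lt _ _ ji)); rewrite lerN2; exact/g_le/nu_ge.
  by apply: le_trans (lerD h1 (lerD h2 h3)); lra.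
have fx_ge j : s j + e - 3 * 2^-1 ^+ j <= sval (f (nu j)) x.
  apply: (cvgr_to_ge (xP (f (nu j)))).
  by apply: oU; exists j.+1 => // m /= jm; exact: fp_ge.
(* Both [s j] and [sval (f (nu j)) x] tend to [sval h x], so the limit inequality reads
   [sval h x + e <= sval h x]. *)
have lhs : (fun j => s j + e - 3 * 2^-1 ^+ j) @ U --> sval h x + e - 3 * 0.
  apply: cvgB; first by apply: cvgD s_cvg _; exact: cvg_cst.
  by apply: cvgM g_cvg; exact: cvg_cst.
have : sval h x + e - 3 * 0 <= sval h x.
  exact: (ler_cvg_to lhs (hP x) (nearW _ fx_ge)).
by rewrite mulr0 subr0 gerDl leNgt e0.
Qed.

(* An [eps]-version of absolute continuity: on the order interval [[0, z]] the
   operator [S] is controlled by a single positive functional, because the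
   adjoint image of the unit ball is uniformly integrable there. *)
Lemma order_weakly_compact_functional (M e : R) :
  (forall u, `|S u| <= M * `|u|) -> 0 < e ->
  exists (phi : {linear F -> R^o}) (C : R), [/\ positive_functional phi, 0 <= C,
    forall u, phi u <= C * `|u| &
    forall w, 0 <=v w -> w <=v z -> `|S w| <= phi w + e].
Proof.
move=> SM e0; apply: contrapT => nphi.
pose G := {phi : {linear F -> R^o} | positive_functional phi /\
  exists2 C, 0 <= C & forall u, phi u <= C * `|u|}.
(* A stage consists of a point, a functional of norm at most [1] large on its image, and a positive
   functional dominating its composite with [S]. *)
pose T := (F * continuous_dual X * G)%type.
pose P (s : seq T) (t : T) := [/\ 0 <=v t.1.1 /\ t.1.1 <=v z,
  forall u, `|sval t.1.2 u| <= `|u|,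
  forall u, 0 <=v u -> `|sval t.1.2 (S u)| <= sval t.2 u,
  e <= sval t.1.2 (S t.1.1) &
  \sum_(r <- s) sval r.2 t.1.1 <= 2^-1 ^+ size s].
have M0 : 0 <= `|M| by [].
have SM' u : `|S u| <= `|M| * `|u|.
  by apply: le_trans (SM u) _; rewrite ler_wpM2r// ler_norm.
have sumG (s : seq T) (k : R) : 0 <= k -> exists phi : {linear F -> R^o},
    [/\ positive_functional phi, exists2 C, 0 <= C & forall u, phi u <= C * `|u| &
     forall u, phi u = k * \sum_(r <- s) sval r.2 u].
  move=> k0.
  have [phi phiE] : exists phi : {linear F -> R^o},
      forall u, phi u = k * \sum_(r <- s) sval r.2 u.
    apply: linear_ex => b u v.
    under eq_bigr do rewrite linearP.
    by rewrite big_split/= -scaler_sumr mulrDr -scalerAr.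
  exists phi; split=> //.
    move=> u u0; rewrite phiE mulr_ge0// sumr_ge0// => r _.
    by case: (svalP r.2) => r0 _; exact: r0.
  have [C C0 CE] : exists2 C, 0 <= C & forall u, \sum_(r <- s) sval r.2 u <= C * `|u|.
    elim: s {phi phiE} => [|r s [C C0 IH]].
      by exists 0 => // u; rewrite big_nil mul0r.
    case: (svalP r.2) => _ [C' C'0 rC]; exists (C' + C); first exact: addr_ge0.
    by move=> u; rewrite big_cons mulrDl lerD.
  exists (k * C); first exact: mulr_ge0.
  by move=> u; rewrite phiE -mulrA ler_wpM2l.
have [t tP] : exists t : nat -> T, forall n, P (mkseq t n) (t n).
  apply: dependent_sequence => s.
  pose B := `|M| * `|z|; have B0 : 0 <= B by rewrite mulr_ge0.
  (* With this multiple of the sum of the earlier functionals as [Phi], the bound [Phi w + e < B]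
     forces that sum to be at most [2^-n] at [w], where [n] is the number of stages. *)
  have k0 : 0 < (B + 1) * 2 ^+ size s by rewrite mulr_gt0 ?exprn_gt0//; lra.
  have [Phi [Phi0 [C C0 PhiC] PhiE]] := sumG s _ (ltW k0).
  have [w [w0 wz Sw]] : exists w, [/\ 0 <=v w, w <=v z & Phi w + e < `|S w|].
    apply: contrapT => nw; apply: nphi; exists Phi, C; split => // w w0 wz.
    by rewrite leNgt; apply/negP => Sw; apply: nw; exists w.
  have [f f1 fE] := norming_functional (S w).
  have [fS fSE] : exists fS : {linear F -> R^o}, forall u, fS u = sval f (S u).
    by apply: linear_ex => b u v; rewrite !linearP.
  have [|phi [phi0 fphi phiC]] := @dominating_positive_functional R F fS `|M| M0.
    move=> v; rewrite fSE; apply: le_trans (ler_norm _) _.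
    exact: le_trans (f1 _) (SM' _).
  have phiG : positive_functional phi /\ exists2 C, 0 <= C & forall u, phi u <= C * `|u|.
    by split=> //; exists (2 * `|M|) => //; rewrite mulr_ge0.
  exists (w, f, exist _ phi phiG); split => //=.
  - by move=> u u0; rewrite -fSE fphi.
  - by rewrite fE; have := Phi0 _ w0; lra.
  - have SwB : `|S w| <= B.
      apply: le_trans (SM' w) _; rewrite ler_wpM2l//; exact: norm_vle.
    move: Sw; rewrite PhiE => Sw.
    have : (B + 1) * 2 ^+ size s * \sum_(r <- s) sval r.2 w <= B + 1 by lra.
    rewrite -mulrA -[leRHS]mulr1 ler_pM2l; last by lra.
    by rewrite -ler_pdivlMl ?exprn_gt0// mulr1 exprVn.
apply: (@no_concentrated_sequence (fun n => (t n).1.1) (fun n => (t n).1.2)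
   (fun n => sval (t n).2) e e0).
- by move=> n; case: (tP n).
- by move=> n; case: (tP n).
- by move=> n; case: (svalP (t n).2).
- by move=> n; case: (tP n).
(* The terms are nonnegative, so the bound on their sum over all earlier stages holds for each
   one. *)
- move=> n k nk; case: (tP k) => -[w0 wz] _ _ _.
  rewrite /mkseq big_map size_map size_iota -[iota 0 k]/(iota 0 k).
  rewrite -{1}[k]subn0 -/(index_iota 0 k) big_mkord; apply: le_trans.
  rewrite (bigD1 (Ordinal nk))//= lerDl sumr_ge0// => i _.
  by case: (svalP (t i).2) => p0 _; exact: p0.
- by move=> n; case: (tP n).
Qed.

End order_weakly_compact_domination.

(** * Disjointly weakly compact sets *)

Lemma bounded_setP (R : realType) (V : normedModType R) (A : set V) :
  bounded_set A <-> exists M : R, forall x, A x -> `|x| <= M.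
Proof.
split => [bA|[M AM]].
  have bA' : nbhs (+oo : set_system R) [set M | forall x, A x -> `|x| <= M].
    exact: bA.
  by have [M AM] := filter_ex bA'; exists M.
by apply: filterS (nbhs_pinfty_ge (num_real M)) => r Mr x /AM /le_trans; apply.
Qed.

Section disjointly_weakly_compact_sets.
Variables (R : realType) (E : banachLatticeType R).

Lemma Sol_Sol (A : set E) : Sol (Sol A) `<=` Sol A.
Proof. by move=> x [y [z Az yz] xy]; exists z => //; exact: vle_tran yz. Qed.

Lemma disjointly_weakly_compact_Sol (A : set E) :
  disjointly_weakly_compact A -> disjointly_weakly_compact (Sol A).
Proof.
move=> [/bounded_setP[M AM] Ad]; split.
  apply/bounded_setP; exists M => y [x Ax yx].
  by apply: le_trans (AM x Ax); exact: vle_modulus_norm.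
by move=> u uA ud; apply: Ad ud => n; exact/Sol_Sol/uA.
Qed.

(** If a positive [phi] dominates [f], the partial sums of the [|f (v i)|] are at most [phi] of a
    sum of disjoint moduli, hence at most [phi x]; a convergent series has null terms. *)
Lemma order_interval_disjointly_weakly_compact (x : E) : 0 <=v x ->
  disjointly_weakly_compact [set u | 0 <=v u /\ u <=v x].
Proof.
move=> x0; split.
  by apply/bounded_setP; exists `|x| => u [u0 ux]; exact: norm_vle.
move=> v vx vd; apply/weak_cvgE => f.
have mvx n : modulus (v n) <=v x.
  have [u [u0 ux] vu] := vx n; apply: vle_tran vu _.
  by rewrite modulus_id.
have [C C0 fC] := continuous_dual_bounded f.
have [|phi [phi0 fphi _]] := @dominating_positive_functional R E (sval f) C C0.
  by move=> u; apply: le_trans (fC u); exact: ler_norm.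
have fm u : `|sval f u| <= phi (modulus u).
  rewrite -{1}[u]vposB linearB; apply: le_trans (ler_normB _ _) _.
  by rewrite modulusE linearD lerD ?fphi ?vpos_ge0.
rewrite linear0; apply: cvg_series_cvg_0.
apply: (@normed_cvg R R^o).
apply: nondecreasing_is_cvgn.
  apply/nondecreasing_seqP => n; rewrite -subr_ge0.
  by rewrite (seriesSB (fun k => `|sval f (v k)| : R)).
exists (phi x) => _ [n _ <-].
rewrite -[X in X <= _]/(series (fun k => `|sval f (v k)| : R) n) seriesEord /=.
apply: (@le_trans _ _ (\sum_(i < n) phi (modulus (v i)))).
  by apply: ler_sum => i _; exact: fm.
rewrite -linear_sum; apply: positive_functional_le => //.
by apply: (@sum_disjoint_le R E (fun i => modulus (v i))) => // i; exact: modulus_ge0.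
Qed.

End disjointly_weakly_compact_sets.

(** * DW-compact operators *)

Section DW_compact_operators.
Variables (R : realType) (E F : banachLatticeType R) (T : {linear E -> F}).
Hypothesis DWT : DW_compact T.

(** Precompactness gives a norm limit [l] of the images along [U]. A norming functional of [l],
    composed with [T], is in the dual of [E] and tends to [0] along [v], so [l = 0]. *)
Lemma weakly_null_ultra_le (B : set F) (v : nat -> E) (U : set_system nat) (e : R) :
  UltraFilter U -> \oo `<=` U -> precompact B -> (forall n, B (T (v n))) ->
  weakly_cvg v 0 -> 0 < e -> U [set n | `|T (v n)| <= e].
Proof.
move=> UU oU [K BK [Kc _]] TB v0 e0.
have PU : ProperFilter U by exact: ultra_proper.
move: Kc; rewrite compact_ultra => /(_ _ (fmap_ultra (T \o v) UU))[].
  by apply: (@filterE _ U) => n; exact: BK (TB n).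
move=> l [_ Tl].
suff l0 : l = 0.
  move: Tl; rewrite l0 => /cvgrPdist_le/(_ _ e0).
  by apply: filterS => n /=; rewrite sub0r normrN.
have [f f1 fl] := norming_functional l.
apply/eqP; rewrite -normr_eq0 -fl.
have [M M0 TM] := bounded_fun_norm_linear DWT.1.
have [g gE] : exists g : {linear E -> R^o}, forall u, g u = sval f (T u).
  by apply: linear_ex => b x y; rewrite !linearP.
have [|h hE] := @dual_ex R E g M.
  by move=> u; rewrite gE; exact: le_trans (f1 _) (TM _).
have h0 : (fun n => sval h (v n) : R^o) @ U --> (0 : R^o).
  have /(weak_cvgE _ _)/(_ h) := v0; rewrite linear0 => vh A /vh.
  exact: oU.
have ft : (fun n => sval h (v n) : R^o) @ U --> (sval f l : R^o).
  rewrite (_ : (fun n => _) = (fun n => sval f (T (v n)))); last first.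
    by apply/funext => n; rewrite hE gE.
  apply: (@cvg_comp _ _ _ (T \o v) (sval f : F -> R^o) _ _ _ Tl).
  by case: f {f1 fl gE} => f fc; exact: fc.
by apply/eqP; exact: (norm_cvg_unique ft h0).
Qed.

(* If no [u] worked, one could pick [x n] in [A] leaving a large excess over a huge
   multiple of the previous moduli; subtracting in addition a small multiple of
   [y], the sum of [2^-n |x n|], makes these excesses disjoint. *)
Lemma DW_compact_approx (A : set E) (e : R) : disjointly_weakly_compact A -> 0 < e ->
  exists2 u : E, 0 <=v u & forall x, A x -> `|T (vpos (modulus x - u))| <= e.
Proof.
move=> dA e0; apply: contrapT => nu.
have [x xP] : exists x : nat -> E, forall n, A (x n) /\
    e < `|T (vpos (modulus (x n) -
      4 ^+ size (mkseq x n) *: \sum_(y <- mkseq x n) modulus y))|.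
  apply: (@dependent_sequence E (fun s x => A x /\
    e < `|T (vpos (modulus x - 4 ^+ size s *: \sum_(y <- s) modulus y))|)) => s.
  apply: contrapT => nx; apply: nu.
  exists (4 ^+ size s *: \sum_(y <- s) modulus y).
    by rewrite vle_scale_ge0 ?exprn_ge0// vsumr_ge0// => i _; exact: modulus_ge0.
  move=> x Ax; rewrite leNgt; apply/negP => ex; by apply: nx; exists x.
pose m n := modulus (x n).
have m0 n : 0 <=v m n by exact: modulus_ge0.
pose b n : E := 4 ^+ n *: \sum_(i < n) m i.
have b0 n : 0 <=v b n by rewrite vle_scale_ge0 ?exprn_ge0// vsumr_ge0.
have Ax n : A (x n) by case: (xP n).
have wE n : e < `|T (vpos (m n - b n))|.
  case: (xP n) => _; rewrite size_mkseq /mkseq big_map.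
  by rewrite -{1}[n in iota 0 n]subn0 -/(index_iota 0 n) big_mkord.
have [/bounded_setP[M AM] _] := dA.
have g0 n : 0 <= 2^-1 ^+ n :> R by rewrite exprn_ge0.
have M0 : 0 <= M by exact: le_trans (AM _ (Ax 0%N)).
pose t n : E := 2^-1 ^+ n *: m n.
have t0 n : 0 <=v t n by rewrite vle_scale_ge0.
have /cvg_ex[y ty] : cvgn (series t).
  apply: normed_cvg.
  apply: (@series_le_cvg _ _ (geometric M 2^-1)).
  - by move=> n; exact: normr_ge0.
  - by move=> n; apply: mulr_ge0.
  - move=> n; rewrite -[leLHS]/(`|t n|) normrZ ger0_norm// mulrC.
    by apply: ler_wpM2r => //; rewrite norm_modulus AM.
  - by apply: is_cvg_geometric_series; rewrite ger0_norm; lra.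
have tley n : t n <=v y.
  apply: vle_cvg_lim ty _; exists n.+1 => // k /= nk.
  rewrite /series/= big_mkord (bigD1 (Ordinal nk))//=.
  by rewrite vlerDl// vsumr_ge0.
have y0 : 0 <=v y by exact: vle_tran (t0 0%N) (tley 0%N).
pose v n := vpos (m n - b n - 2^-1 ^+ n *: y).
have v0 n : 0 <=v v n by exact: vpos_ge0.
have vm n : v n <=v m n.
  by rewrite /v vpos_le m0 andbT !vlerBlDr (vle_tran (vlerDl (m n) (b0 n)))//
     -addrA vleD ?vlexx// addrC vlerDl// vle_scale_ge0.
have vA n : Sol A (v n) by exists (x n) => //; rewrite [modulus (v n)]modulus_id.
have vdisj i j : (i < j)%N -> vmeet (v i) (v j) = 0.
  move=> ij.
  (* For [i < j], [v j] is below the positive part of [m j - 4^j m i], and [v i] below that of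
     [m i - c m j] since [2^-j m j <= y]. These are disjoint because [4^j c >= 1]. *)
  pose c : R := 2^-1 ^+ (i + j).
  apply: vle_eq; last by rewrite vmeet_ge0.
  have c1 : c <= 1 by rewrite exprn_ile1//; lra.
  have ac : 1 <= 4 ^+ j * c.
    rewrite /c -(@ler_pM2l _ (2 ^+ (i + j))) ?exprn_gt0// mulr1 mulrCA -exprMn.
    rewrite mulfV// expr1n mulr1 (_ : 4 = 2 ^+ 2)//; last by rewrite -natrX.
    rewrite -exprM ler_eXn2l ?ltr1n//.
    by rewrite mul2n -addnn leq_add2r ltnW.
  have := vmeet_pos_scale_eq0 (m0 j) (m0 i) (g0 _) c1 ac.
  rewrite vmeetC => <-; rewrite vmeet_homo// vpos_homo//.
    rewrite -addrA -opprD vleD ?vlexx// vlerN2 /c exprD -scalerA.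
    by apply: vle_tran (vler_wpZ (g0 i) (tley j)) _; rewrite addrC vlerDl.
  rewrite -addrA -opprD vleD ?vlexx// vlerN2.
  apply: (@vle_tran _ _ (b j)); last by rewrite vlerDl// vle_scale_ge0.
  rewrite /b vler_wpZ ?exprn_ge0// (bigD1 (Ordinal ij))//=.
  by rewrite vlerDl// vsumr_ge0.
have vd : disjoint_seq v.
  move=> i j; rewrite !modulus_id// neq_ltn => /orP[|] ij; first exact: vdisj.
  by rewrite vmeetC; exact: vdisj.
have [_ /(_ v vA vd) vw] := dA.
have [U UU oU] := ultra_nat_ex.
have PU : ProperFilter U by exact: ultra_proper.
have [N N0 TN] := bounded_fun_norm_linear DWT.1.
have e20 : 0 < e / 2 by rewrite divr_gt0.
have Uv := @weakly_null_ultra_le _ v U _ UU oU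
  (DWT.2 _ (disjointly_weakly_compact_Sol dA))
  (fun n => ex_intro2 _ _ (v n) (vA n) erefl) vw e20.
have Ug : U [set n | N * (2^-1 ^+ n * `|y|) <= e / 2].
  have half : `|2^-1 : R| < 1 by rewrite ger0_norm; lra.
  have gN : (fun n => N * (2^-1 ^+ n * `|y|)) @ \oo --> (N * (0 * `|y|) : R).
    apply: cvgM; first exact: cvg_cst.
    apply: cvgM; last exact: cvg_cst.
    exact: cvg_expr.
  rewrite mul0r mulr0 in gN.
  apply: oU; have /cvgrPdist_le/(_ _ e20) := gN.
  by apply: filterS => n /=; rewrite sub0r normrN; apply: le_trans; exact: ler_norm.
have [n /= [n1 n2]] := filter_ex (filterI Uv Ug).
have := wE n; rewrite -[vpos (m n - b n)](subrK (v n)) linearD.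
(* Dropping the multiple of [y] changes the excess by at most [2^-n] times the norm of [y]; with
   [n1] and [n2] its image then has norm at most [e], against the choice of [x n]. *)
have wv : `|vpos (m n - b n) - v n| <= 2^-1 ^+ n * `|y|.
  rewrite -[2^-1 ^+ n]ger0_norm// -normrZ; apply: norm_vle.
    rewrite vsubr_ge0 /v vpos_homo// vlerBlDr vlerDl// vle_scale_ge0//.
  rewrite vlerBlDr [X in _ <=v X]addrC vpos_le; apply/andP; split.
    by rewrite -vlerBlDr vle_pos.
  by rewrite vaddr_ge0// vle_scale_ge0.
have := ler_normD (T (vpos (m n - b n) - v n)) (T (v n)).
have := le_trans (TN _) (ler_wpM2l N0 wv).
by lra.
Qed.

End DW_compact_operators.

(** * The composition on order intervals *)

Section dominated_operators.
Variables (R : realType) (E F : banachLatticeType R) (X : completeNormedModType R).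
Variables (S1 T : {linear E -> F}) (S2 : {linear F -> X}).
Hypotheses (S1p : positive_operator S1) (S1T : operator_le S1 T).
Hypotheses (DWT : DW_compact T) (S2wc : order_weakly_compact S2).

(** The positive and negative parts of [S1 (k y) - S1 (k y')] lie between [0] and [T u], so [S2] is
    controlled there by [phi] up to [e / 4] each, and [phi] of the modulus is at most [e / 4] by
    domination. *)
Lemma order_interval_cauchy_along (Y : Type) (U : set_system Y) (k : Y -> E) (u : E) :
  UltraFilter U -> 0 <=v u -> (forall y, 0 <=v k y /\ k y <=v u) ->
  cauchy_along U (fun y => S2 (S1 (k y))).
Proof.
move=> UU u0 ku e e0.
have PU : ProperFilter U by exact: ultra_proper.
have [M M0 S2M] := bounded_fun_norm_linear S2wc.1.
have Swc : relatively_weakly_compact (S2 @` [set v | 0 <=v v /\ v <=v T u]).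
  by apply: S2wc.2; exists 0, (T u).
have e40 : 0 < e / 4 by rewrite divr_gt0.
have [phi [C [phi0 C0 phiC S2phi]]] := order_weakly_compact_functional Swc S2M e40.
have Tc (x' : E) (k' : Y -> E) : 0 <=v x' ->
    (forall y, 0 <=v k' y /\ k' y <=v x') -> cauchy_along U (T \o k').
  move=> x'0 k'x'; apply: (precompact_cauchy_along
    (DWT.2 _ (order_interval_disjointly_weakly_compact x'0)) UU).
  by apply: (@filterE _ U) => y; exists (k' y).
have [D UD Dphi] := dominated_cauchy_along S1p S1T _ phi0 C0 phiC u0 ku Tc e40.
exists D => // y y' Dy Dy'.
have S1k v : 0 <=v S1 (k v) /\ S1 (k v) <=v T u.
  have [k0 kv] := ku v; split; first exact: S1p.
  apply: vle_tran (S1T u0); rewrite -vsubr_ge0 -linearB S1p// vsubr_ge0//.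
have pos_le v v' : vpos (S1 (k v) - S1 (k v')) <=v T u.
  have [a0 az] := S1k v; have [b0 bz] := S1k v'.
  rewrite vpos_le (vle_tran a0 az) andbT vlerBlDr.
  by apply: vle_tran az _; rewrite vlerDl.
have := Dphi _ _ Dy Dy'; rewrite modulusE linearD opprB => phile.
rewrite -linearB -[S1 (k y) - _]vposB opprB linearB.
apply: le_trans (ler_normB _ _) _.
have := S2phi _ (vpos_ge0 _) (pos_le y y'); have := S2phi _ (vpos_ge0 _) (pos_le y' y).
by lra.
Qed.

End dominated_operators.

Theorem corollary2p13 (R : realType) (E F : banachLatticeType R)
    (X : completeNormedModType R)
    (S1 : {linear E -> F}) (S2 : {linear F -> X}) :
  bounded_fun_norm S1 ->
  positive_operator S1 ->
  (exists T : {linear E -> F},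
     [/\ DW_compact T, positive_operator T & operator_le S1 T]) ->
  order_weakly_compact S2 ->
  DW_compact (S2 \o S1).
Proof.
move=> S1b S1p [T [DWT Tp S1T]] S2wc; split.
  move=> r; have [M1 S1M] := S1b r; have [M2 S2M] := S2wc.1 M1.
  by exists M2 => x xr; exact/S2M/S1M.
have [M M0 S2M] := bounded_fun_norm_linear S2wc.1.
move=> A dA; apply: cauchy_along_precompact => U UU UA e e0.
have PU : ProperFilter U by exact: ultra_proper.
(* Makes [M * e1] at most [e / 8], the error that [S2] leaves on each part above [u]. *)
pose e1 := e / (8 * (M + 1)).
have e10 : 0 < e1 by rewrite divr_gt0//; lra.
have Me1 : M * e1 <= e / 8.
  have -> : e / 8 = (M + 1) * e1 by rewrite /e1; field; lra.
  by rewrite ler_wpM2r ?ltW//; lra.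
have [u u0 Tu] := DW_compact_approx DWT dA e10.
have kb x : 0 <=v vmeet (vpos x) u /\ vmeet (vpos x) u <=v u.
  by rewrite vmeet_ge0 ?vpos_ge0 ?vle_meetr.
have e40 : 0 < e / 4 by rewrite divr_gt0.
have [D1 UD1 HD1] := order_interval_cauchy_along S1p S1T DWT S2wc UU u0 kb e40.
have [D2 UD2 HD2] := order_interval_cauchy_along S1p S1T DWT S2wc UU u0
  (fun x => kb (- x)) e40.
exists (A `&` (D1 `&` D2)); first by do 2?apply: filterI.
have rest v x : v <=v modulus x -> A x -> `|S2 (S1 (vpos (v - u)))| <= e / 8.
  move=> vx Ax; apply: le_trans Me1; apply: le_trans (S2M _) _.
  apply: ler_wpM2l => //; apply: le_trans (Tu x Ax).
  apply: norm_vle; first by rewrite S1p ?vpos_ge0.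
  apply: vle_tran (S1T _ (vpos_ge0 _)) _.
  rewrite -vsubr_ge0 -linearB Tp// vsubr_ge0 vpos_homo// vleD ?vlexx//.
(* Each of the positive and negative parts of [x] is its truncation at [u] plus its excess over
   [u]. *)
have decomp x : S2 (S1 x) =
    (S2 (S1 (vmeet (vpos x) u)) + S2 (S1 (vpos (vpos x - u)))) -
    (S2 (S1 (vmeet (vpos (- x)) u)) + S2 (S1 (vpos (vpos (- x) - u)))).
  by rewrite -!linearD -!linearB !vmeetE !subrK vposB.
have bound x : A x -> `|S2 (S1 x) -
    (S2 (S1 (vmeet (vpos x) u)) - S2 (S1 (vmeet (vpos (- x)) u)))| <= e / 4.
  move=> Ax; rewrite decomp; set a := S2 (S1 (vmeet (vpos x) u)).
  set b := S2 (S1 (vmeet _ u)); set r := S2 _; set r' := S2 _.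
  rewrite [- (b + r')]opprD addrACA [_ - (a - b)]addrAC subrr add0r.
  apply: le_trans (ler_normB _ _) _.
  have := rest _ _ (vpos_le_modulus x) Ax.
  have := vpos_le_modulus (- x); rewrite modulusN => /rest /(_ Ax).
  by rewrite -/r -/r'; lra.
move=> y y' [Ay [D1y D2y]] [Ay' [D1y' D2y']] /=.
have := HD1 _ _ D1y D1y'; have := HD2 _ _ D2y D2y'.
have := bound _ Ay; have := bound _ Ay'.
set s := S2 (S1 y); set s' := S2 (S1 y').
set a := S2 _; set b := S2 _; set a' := S2 _; set b' := S2 _.
(* Four errors of [e / 4]: the excesses over [u] at [y] and at [y'], and the variation of the two
   truncated parts. *)
move=> h1 h2 h3 h4.
apply: le_trans (ler_distD (a' - b') _ _) _.
apply: le_trans (lerD (lexx _) (ler_distD (a - b) _ _)) _.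
have := ler_normB (a' - a) (b' - b).
rewrite (_ : a' - a - (b' - b) = a' - b' - (a - b)); last first.
  by rewrite !opprB [b - b']addrC addrACA [- a + b]addrC.
by rewrite [`|a - b - s'|]distrC; lra.
Qed.
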